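(* Let $n\ge 1$ and let $F:\mathrm{LC}_n^{sc}\to\mathbb{R}$ be a linear and increasing functional. Then there exists a unique positive and finite Borel measure $\mu$ on $\mathbb{R}^n$ with compact support such that $F(f)=\int_{\mathbb{R}^n}h_f\,d\mu$ for all $f\in\mathrm{LC}_n^{sc}$.
   Context: A function $f:\mathbb{R}^n\to[0,\infty)$, not identically $0$, is log-concave if $f=e^{-\phi}$ with $\phi:\mathbb{R}^n\to(-\infty,\infty]$ convex. $\mathrm{LC}_n$ is the class of all upper semi-continuous log-concave functions on $\mathbb{R}^n$. The function $f=e^{-\phi}$ is super-coercive if $\lim_{|x|\to\infty}\phi(x)/|x|=\infty$. $\mathrm{LC}_n^{sc}$ is the class of super-coercive functions in $\mathrm{LC}_n$. For $f,g\in\mathrm{LC}_n^{sc}$ the sup-convolution is $(f\star g)(x)=\sup_{y\in\mathbb{R}^n} f(y)g(x-y)$, which is again in $\mathrm{LC}_n^{sc}$. For $\lambda>0$ the dilation is $(\lambda\cdot f)(x)=f(x/\lambda)^{\lambda}$. The support function of $f\in\mathrm{LC}_n$ is $h_f=(-\log f)^{*}$, where $\phi^{*}(y)=\sup_{x\in\mathbb{R}^n}(\langle x,y\rangle-\phi(x))$ is the Legendre transform. A functional $F:\mathrm{LC}_n^{sc}\to\mathbb{R}$ is linear if $F((\alpha\cdot f)\star(\beta\cdot g))=\alpha F(f)+\beta F(g)$ for all $f,g\in\mathrm{LC}_n^{sc}$ and all $\alpha,\beta>0$. It is increasing if $f\ge g$ pointwise implies $F(f)\ge F(g)$. *)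

(* Defs.v *)
From HB Require Import structures.
From mathcomp Require Import all_boot all_order all_algebra.
From mathcomp Require Import all_classical all_reals all_analysis.

Set Implicit Arguments.
Unset Strict Implicit.
Unset Printing Implicit Defensive.

Import Order.TTheory GRing.Theory Num.Theory.
Import numFieldNormedType.Exports.

Local Open Scope classical_set_scope.
Local Open Scope ring_scope.

Section LogConcave.
Variables (R : realType) (n : nat).
Local Notation E := 'rV[R]_n.

Definition dot (x y : E) : R := \sum_(i < n) x 0 i * y 0 i.

(* The library norm on row vectors is the sup norm. *)
Definition enorm (x : E) : R := Num.sqrt (dot x x).

Definition at_infinity : set_system E :=
  filter_from setT (fun r : R => [set x : E | r < enorm x]).

Global Instance at_infinity_filter : Filter at_infinity.
Proof.
apply: filter_from_filter; first by exists 0.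
move=> r s _ _; exists (Num.max r s) => // x /=.
by rewrite gt_max => /andP[].
Qed.

(* In [\bar R], 0 * +oo = 0, so the endpoints t = 0, 1 are harmless. *)
Definition econvex (phi : E -> \bar R) : Prop :=
  forall (x y : E) (t : R), 0 <= t <= 1 ->
    (phi (t *: x + (1 - t) *: y)%R <= t%:E * phi x + (1 - t)%:E * phi y)%E.

Definition log_concave (f : E -> R) : Prop :=
  (exists x, f x != 0) /\
  exists phi : E -> \bar R,
    [/\ forall x, (-oo < phi x)%E,
        econvex phi
      & forall x, (f x)%:E = expeR (- phi x)%E].

Definition upper_semicontinuous (f : E -> R) : Prop :=
  lower_semicontinuous (fun x => (- f x)%:E).

Definition LC : set (E -> R) :=
  [set f | log_concave f /\ upper_semicontinuous f].

(* [lne 0 = -oo], so this is +oo where f vanishes. *)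
Definition neglog (f : E -> R) (x : E) : \bar R := (- lne (f x)%:E)%E.

Definition super_coercive (f : E -> R) : Prop :=
  (neglog f x * ((enorm x)^-1)%:E)%E @[x --> at_infinity] --> +oo%E.

Definition LCsc : set (E -> R) := [set f | LC f /\ super_coercive f].

(* A real supremum: it is finite for f and g in LCsc, which are bounded. *)
Definition sup_convolution (f g : E -> R) (x : E) : R :=
  sup [set f y * g (x - y) | y in [set: E]].

Definition dilation (l : R) (f : E -> R) (x : E) : R := f (l^-1 *: x) `^ l.

Definition legendre (phi : E -> \bar R) (y : E) : \bar R :=
  ereal_sup [set ((dot x y)%:E - phi x)%E | x in [set: E]].

Definition support_function (f : E -> R) : E -> \bar R := legendre (neglog f).

(* Functionals on LCsc are given by functions on all of [E -> R], of which only
   the values on LCsc matter; LCsc is closed under [dilation] (l > 0) and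
   [sup_convolution]. *)
Definition linear_functional (F : (E -> R) -> R) : Prop :=
  forall (f g : E -> R) (a b : R), LCsc f -> LCsc g -> 0 < a -> 0 < b ->
    F (sup_convolution (dilation a f) (dilation b g)) = a * F f + b * F g.

Definition increasing_functional (F : (E -> R) -> R) : Prop :=
  forall f g : E -> R, LCsc f -> LCsc g ->
    (forall x, g x <= f x) -> F g <= F f.

Definition borelE := g_sigma_algebraType (@open E).

Definition measure_support (mu : {measure set borelE -> \bar R}) : set E :=
  [set x | forall U : set E, open U -> U x -> (0 < mu U)%E].

Definition represents (F : (E -> R) -> R)
    (mu : {measure set borelE -> \bar R}) : Prop :=
  forall f : E -> R, LCsc f ->
    (F f)%:E = (\int[mu]_x support_function f x)%E.

End LogConcave.

(* Main.v *)
Require Import Defs.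
From HB Require Import structures.
From mathcomp Require Import all_boot all_order all_algebra.
From mathcomp Require Import all_classical all_reals all_analysis.
From mathcomp Require Import measurable_realfun.
From mathcomp Require Import ring lra.

Set Implicit Arguments.
Unset Strict Implicit.
Unset Printing Implicit Defensive.

Import Order.TTheory GRing.Theory Num.Theory.
Import numFieldNormedType.Exports.

Local Open Scope classical_set_scope.
Local Open Scope ring_scope.

(** The support function turns the problem into one about convex functions.
    For a finite convex function h on R^n put
      exp_conj h x = inf_y exp (h y - <x,y>) = exp (- h^* x).
    Fenchel-Moreau duality makes f |-> h_f a monotone bijection from LC_n^sc
    onto the finite convex functions, with inverse [exp_conj]
    ([supp_exp_conj], [exp_conj_suppE]); it carries dilation and
    sup-convolution to multiplication by scalars and addition
    ([exp_conj_dilation], [exp_conj_sup_convolution]).  Hence F is a functional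
    G h = F (exp_conj h) on the cone of finite convex functions which is
    additive, positively homogeneous and monotone.

    The differences of finite convex functions form a vector space which is
    closed under positive parts and, since the square of a nonnegative convex
    function is convex, under products.  G extends to a positive linear
    functional L on it ([cone_extension]).  Each difference is continuous, so
    Dini's theorem on balls applies, and 1 <= e |x| outside a large ball
    controls what happens at infinity: L is countably subadditive
    ([dc_functional_series]).  The Daniell construction then yields a finite
    measure mu with L v equal to the integral of v ([daniell_representation]).
    It is a Borel measure because for a closed set C the function d(x,C)^2 is
    a difference of convex functions, so that the indicator of each open set is
    an increasing limit of such differences ([open_dc_exhausted]).  The same
    fact determines mu on open sets, hence everywhere
    ([integral_dc_measure_unique]).

    Compactness of the support comes from finiteness: if mu charged the
    complement of every ball, a convex function growing fast enough would have
    infinite integral ([compact_measure_support]). *)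

(** * Convex functions and their differences *)

Section Convex.
Variables (R : realType) (V : lmodType R).
Implicit Types (h g v w : V -> R).

Definition cvx h := forall x y t, 0 <= t <= 1 ->
  h (t *: x + (1 - t) *: y) <= t * h x + (1 - t) * h y.

Lemma cvx_cst (c : R) : cvx (fun=> c).
Proof. by move=> x y t _ /=; lra. Qed.

Lemma cvxD h g : cvx h -> cvx g -> cvx (fun x => h x + g x).
Proof. by move=> ch cg x y t t01; have := ch x y t t01; have := cg x y t t01; lra. Qed.

Lemma cvxZ h (a : R) : 0 <= a -> cvx h -> cvx (fun x => a * h x).
Proof. by move=> a0 ch x y t t01; have := ch x y t t01; nra. Qed.

Lemma cvx_max h g : cvx h -> cvx g -> cvx (fun x => Num.max (h x) (g x)).
Proof.
move=> ch cg x y t /[dup] t01 /andP[t0 t1]; rewrite ge_max; apply/andP; split.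
  apply: le_trans (ch x y t t01) _.
  by apply: lerD; apply: ler_wpM2l; rewrite ?subr_ge0// le_max lexx.
apply: le_trans (cg x y t t01) _.
by apply: lerD; apply: ler_wpM2l; rewrite ?subr_ge0// le_max lexx orbT.
Qed.

Lemma cvx_opp h : cvx h -> cvx (fun x => h (- x)).
Proof.
by move=> ch x y t t01; have := ch (- x) (- y) t t01; rewrite !scalerN -opprD.
Qed.

(** The square is convex and nondecreasing on nonnegative numbers.  This is what
    makes differences of convex functions an algebra. *)
Lemma cvx_sqr h : (forall x, 0 <= h x) -> cvx h -> cvx (fun x => h x ^+ 2).
Proof.
move=> h0 ch x y t t01; have hc := ch x y t t01.
have := h0 x; have := h0 y; have := h0 (t *: x + (1 - t) *: y) => *.
apply: (@le_trans _ _ ((t * h x + (1 - t) * h y) ^+ 2)); first by nra.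
suff : 0 <= t * (1 - t) * (h x - h y) ^+ 2 by nra.
by apply: mulr_ge0; rewrite ?sqr_ge0//; nra.
Qed.

Lemma cvx_sup (I : Type) (D : set I) (u : I -> V -> R) : D !=set0 ->
  (forall i, D i -> cvx (u i)) ->
  (forall x, has_ubound [set u i x | i in D]) ->
  cvx (fun x => sup [set u i x | i in D]).
Proof.
move=> [i0 Di0] cu ub x y t /[dup] t01 /andP[t0 t1].
apply: ge_sup; first by exists (u i0 (t *: x + (1 - t) *: y)), i0.
move=> _ [i Di <-]; apply: le_trans (cu i Di x y t t01) _.
by apply: lerD; apply: ler_wpM2l; rewrite ?subr_ge0//; apply: ub_le_sup => //; exists i.
Qed.

Lemma cvx_mid h x y : cvx h -> h x + h y >= 2 * h (2^-1 *: (x + y)).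
Proof.
move=> ch; have /(ch x y) : 0 <= (2^-1 : R) <= 1 by lra.
rewrite (_ : 1 - 2^-1 = 2^-1 :> R); last by lra.
by rewrite -scalerDr; lra.
Qed.

(** Differences of two finite convex functions, often called DC functions. *)
Definition dc v := exists h g, [/\ cvx h, cvx g & forall x, v x = h x - g x].

Lemma dc_cvx h : cvx h -> dc h.
Proof.
move=> ch; exists h, (fun=> 0); split => //; last by move=> x; rewrite subr0.
exact: cvx_cst.
Qed.

Lemma dc_cst (c : R) : dc (fun=> c). Proof. exact/dc_cvx/cvx_cst. Qed.

Lemma dcD v w : dc v -> dc w -> dc (fun x => v x + w x).
Proof.
move=> [h [g [ch cg vE]]] [h' [g' [ch' cg' wE]]].
exists (fun x => h x + h' x), (fun x => g x + g' x).
by split; [exact: cvxD|exact: cvxD|move=> x; rewrite vE wE; lra].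
Qed.

Lemma dcZ v (a : R) : dc v -> dc (fun x => a * v x).
Proof.
move=> [h [g [ch cg vE]]]; have [a0|/ltW a0] := leP 0 a.
  exists (fun x => a * h x), (fun x => a * g x).
  by split; [exact: cvxZ|exact: cvxZ|move=> x; rewrite vE; lra].
exists (fun x => - a * g x), (fun x => - a * h x).
by split; [apply: cvxZ => //; lra|apply: cvxZ => //; lra|move=> x; rewrite vE; lra].
Qed.

Lemma dcB v w : dc v -> dc w -> dc (fun x => v x - w x).
Proof.
move=> dv /(dcZ (- 1)) /(dcD dv); congr dc.
by apply/funext => x; rewrite mulN1r.
Qed.

(** max (h - g, 0) = max (h, g) - g. *)
Lemma dc_pos v : dc v -> dc (fun x => Num.max (v x) 0).
Proof.
move=> [h [g [ch cg vE]]].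
exists (fun x => Num.max (h x) (g x)), g; split => //; first exact: cvx_max.
move=> x; rewrite vE.
by case: (leP (h x) (g x)) => ?; case: (leP (h x - g x) 0) => ?; lra.
Qed.

Lemma dc_min v w : dc v -> dc w -> dc (fun x => Num.min (v x) (w x)).
Proof.
move=> dv dw; have := dcB dv (dc_pos (dcB dv dw)); congr dc; apply/funext => x.
by case: (leP (v x) (w x)) => ?; case: (leP (v x - w x) 0) => ?; lra.
Qed.

(** By midpoint convexity 2 h(0) <= h(x) + h(-x), so x |-> h(-x) - 2 h(0) is a
    convex bound of - h; this avoids looking for an affine minorant of h. *)
Lemma cvx_opp_ubound h : cvx h -> exists2 g, cvx g & forall x, - h x <= g x.
Proof.
move=> ch; exists (fun x => h (- x) + (- (2 * h 0))).
  by apply: cvxD; [exact: cvx_opp|exact: cvx_cst].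
by move=> x; have := cvx_mid x (- x) ch; rewrite subrr scaler0; lra.
Qed.

(** Adding to both members a convex function that dominates their opposites
    leaves the difference unchanged and makes both of them nonnegative. *)
Lemma dc_nneg v : dc v -> exists h g,
  [/\ cvx h, cvx g, forall x, 0 <= h x, forall x, 0 <= g x
    & forall x, v x = h x - g x].
Proof.
move=> [h [g [ch cg vE]]].
have [h' ch' hh'] := cvx_opp_ubound ch; have [g' cg' gg'] := cvx_opp_ubound cg.
pose c x := Num.max (h' x) (g' x); have cc : cvx c by exact: cvx_max.
exists (fun x => h x + c x), (fun x => g x + c x); split.
- exact: cvxD.
- exact: cvxD.
- by move=> x; have := hh' x; have : h' x <= c x by [rewrite le_max lexx]; lra.
- by move=> x; have := gg' x; have : g' x <= c x by [rewrite le_max lexx orbT]; lra.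
- by move=> x; rewrite vE; lra.
Qed.

(** (h - g)^2 = 2 h^2 + 2 g^2 - (h + g)^2, where every square on the right is
    convex once h and g are nonnegative. *)
Lemma dc_sqr v : dc v -> dc (fun x => v x ^+ 2).
Proof.
move=> /dc_nneg[h [g [ch cg h0 g0 vE]]].
exists (fun x => 2 * h x ^+ 2 + 2 * g x ^+ 2), (fun x => (h x + g x) ^+ 2); split.
- by apply: cvxD; apply: cvxZ => //; exact: cvx_sqr.
- by apply: cvx_sqr; [move=> x; exact: addr_ge0|exact: cvxD].
- by move=> x; rewrite vE; ring.
Qed.

(** Polarization reduces products to squares. *)
Lemma dcM v w : dc v -> dc w -> dc (fun x => v x * w x).
Proof.
move=> dv dw.
have := dcZ 2^-1 (dcB (dc_sqr (dcD dv dw)) (dcD (dc_sqr dv) (dc_sqr dw))).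
by congr dc; apply/funext => x; field.
Qed.

End Convex.

Lemma cvx_norm (R : realType) (V : normedModType R) : cvx (fun x : V => `|x|).
Proof.
move=> x y t /andP[t0 t1]; apply: le_trans (ler_normD _ _) _.
by rewrite !normrZ !ger0_norm ?subr_ge0.
Qed.

Section Dot.
Variables (R : realType) (n : nat).
Local Notation E := 'rV[R]_n.
Implicit Types (x y z : E).

Lemma dotC x y : dot x y = dot y x.
Proof. by apply: eq_bigr => i _; rewrite mulrC. Qed.

Lemma dotDl x y z : dot (x + y) z = dot x z + dot y z.
Proof. by rewrite /dot -big_split; apply: eq_bigr => i _; rewrite mxE mulrDl. Qed.

Lemma dotZl a x z : dot (a *: x) z = a * dot x z.
Proof. by rewrite /dot mulr_sumr; apply: eq_bigr => i _; rewrite mxE mulrA. Qed.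

Lemma dotNl x z : dot (- x) z = - dot x z.
Proof. by rewrite -scaleN1r dotZl mulN1r. Qed.

Lemma dotBl x y z : dot (x - y) z = dot x z - dot y z.
Proof. by rewrite dotDl dotNl. Qed.

Lemma dot0l z : dot 0 z = 0.
Proof. by rewrite -(scale0r (0 : E)) dotZl mul0r. Qed.

Lemma dot_suml (I : Type) (r : seq I) (P : pred I) (u : I -> E) z :
  dot (\sum_(i <- r | P i) u i) z = \sum_(i <- r | P i) dot (u i) z.
Proof.
exact: (big_morph (fun v => dot v z) (fun a b => dotDl a b z) (dot0l z)).
Qed.

Lemma dotZr a x z : dot x (a *: z) = a * dot x z.
Proof. by rewrite dotC dotZl dotC. Qed.

Lemma dotDr x y z : dot z (x + y) = dot z x + dot z y.
Proof. by rewrite dotC dotDl !(dotC z). Qed.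

Lemma dotBr x y z : dot z (x - y) = dot z x - dot z y.
Proof. by rewrite dotC dotBl !(dotC z). Qed.

Lemma dotxx_ge0 x : 0 <= dot x x.
Proof. by apply: sumr_ge0 => i _; rewrite -expr2 sqr_ge0. Qed.

Lemma coord_le_norm x i : `|x 0 i| <= `|x|.
Proof.
by rewrite [leRHS]/Num.Def.normr/= mx_normrE; apply/bigmax_geP; right => /=; exists (0, i).
Qed.

Lemma norm_le_coord x (c : R) : 0 <= c -> (forall i, `|x 0 i| <= c) -> `|x| <= c.
Proof.
move=> c0 xc; rewrite [leLHS]/Num.Def.normr/= mx_normrE; apply/bigmax_leP; split => //= -[i j] _.
by rewrite ord1.
Qed.

Lemma dot_le_norm x y : dot x y <= (\sum_(i < n) `|y 0 i|) * `|x|.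
Proof.
rewrite mulr_suml; apply: ler_sum => i _; apply: le_trans (ler_norm _) _.
by rewrite normrM mulrC; apply: ler_wpM2l => //; exact: coord_le_norm.
Qed.

Lemma norm_le_enorm x : `|x| <= enorm x.
Proof.
apply: norm_le_coord => [|i]; first exact: sqrtr_ge0.
rewrite -sqrtr_sqr; apply: ler_wsqrtr; rewrite expr2 /dot (bigD1 i)//= lerDl.
by apply: sumr_ge0 => j _; rewrite -expr2 sqr_ge0.
Qed.

Lemma enorm_sqr x : enorm x ^+ 2 = dot x x.
Proof. by rewrite sqr_sqrtr// dotxx_ge0. Qed.

Lemma enorm_ge0 x : 0 <= enorm x. Proof. exact: sqrtr_ge0. Qed.

Lemma cvx_dot y (c : R) : cvx (fun x : E => dot x y + c).
Proof. by move=> x x' t _; rewrite dotDl !dotZl; lra. Qed.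

Lemma cvx_dotxx : cvx (fun x : E => dot x x).
Proof.
move=> x y t t01; rewrite !(dotDl, dotDr, dotZl, dotZr).
have := dotxx_ge0 (x - y); rewrite !(dotBl, dotBr) (dotC y x) => ?.
suff : 0 <= t * (1 - t) * (dot x x - dot x y - (dot x y - dot y y)) by lra.
by apply: mulr_ge0 => //; nra.
Qed.

End Dot.

(** * Subgradients and continuity of convex functions *)

(** The one-dimensional step of the Hahn-Banach argument, in Lagrange multiplier
    form.  Convexity of q along a segment joining a point where l < 0 to a point
    where l > 0 orders the slopes q / l, and c is the supremum of those on the
    negative side. *)
Lemma cvx_multiplier (R : realType) (V : lmodType R) (D : set V)
    (q l : V -> R) :
  (forall x y t, D x -> D y -> 0 <= t <= 1 -> D (t *: x + (1 - t) *: y)) ->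
  cvx q ->
  (forall x y t, l (t *: x + (1 - t) *: y) = t * l x + (1 - t) * l y) ->
  (exists2 x, D x & 0 < l x) -> (exists2 x, D x & l x < 0) ->
  (forall x, D x -> l x = 0 -> 0 <= q x) ->
  exists c, forall x, D x -> c * l x <= q x.
Proof.
move=> Dc cq ll [p Dp lp] [m Dm lm] q0.
have slope x x' : D x -> D x' -> 0 < l x -> l x' < 0 ->
    q x' / l x' <= q x / l x.
  move=> Dx Dx' lx lx'.
  have lxx' : 0 < l x - l x' by lra.
  (* at this t the segment from x to x' crosses the kernel of l *)
  pose t := l x / (l x - l x').
  have tl : t * (l x - l x') = l x by rewrite divfK// gt_eqF.
  have t01 : 0 <= t <= 1 by apply/andP; split; nra.
  have := q0 _ (Dc _ _ _ Dx' Dx t01).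
  have -> : l (t *: x' + (1 - t) *: x) = 0 by rewrite ll; lra.
  move=> /(_ erefl) qt0; have := cq x' x t t01 => qt.
  have {qt0 qt} qt : 0 <= t * q x' + (1 - t) * q x by lra.
  rewrite -(opprK (l x')) invrN mulrN -mulNr ler_pdivlMr; last by lra.
  rewrite mulrAC ler_pdivrMr ?oppr_gt0//.
  have : 0 <= (t * q x' + (1 - t) * q x) * (l x - l x') by apply: mulr_ge0 => //; lra.
  rewrite (_ : _ * _ = q x' * (t * (l x - l x')) + q x * (l x - l x' - t * (l x - l x'))); last by ring.
  by rewrite tl; lra.
pose S := [set q x / l x | x in [set x | D x /\ l x < 0]].
have S0 : S !=set0 by exists (q m / l m), m.
have Sub : ubound S (q p / l p) by move=> _ [x [Dx lx] <-]; exact: slope.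
exists (sup S) => x Dx; have [lx|lx|lx] := ltgtP (l x) 0.
- rewrite -ler_ndivrMr//; apply: ub_le_sup; [by exists (q p / l p)|by exists x].
- rewrite -ler_pdivlMr//; apply: ge_sup => // _ [x' /= [Dx' lx'] <-]; exact: slope.
- by rewrite lx mulr0; exact: q0.
Qed.

Section Subgradient.
Variables (R : realType) (n : nat).
Local Notation E := 'rV[R]_n.
Implicit Types (h : E -> R).

Lemma cvx_translate h a : cvx h -> cvx (fun x => h (a + x)).
Proof.
move=> ch x y t t01; have := ch (a + x) (a + y) t t01.
by rewrite !scalerDr addrACA -scalerDl subrKC scale1r.
Qed.

(** The subgradient is built one coordinate at a time: y works on the span of the
    first k basis vectors, and [cvx_multiplier], applied to h(x + z) - h(x) - <z,y>
    and to the next coordinate, gives the correction of y along that coordinate. *)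
Lemma cvx_subgradient h x : cvx h -> exists y, forall z, h x + dot (z - x) y <= h z.
Proof.
move=> ch; have cq := cvx_translate x ch; pose q z := h (x + z).
suff [y hy] : exists y, forall z : E, h x + dot z y <= q z.
  by exists y => z; have := hy (z - x); rewrite /q subrKC.
suff H k : (k <= n)%N -> exists y, forall z : E,
    (forall i : 'I_n, (k <= i)%N -> z 0 i = 0) -> h x + dot z y <= q z.
  have [y hy] := H n (leqnn n); exists y => z; apply: hy => i.
  by rewrite leqNgt ltn_ord.
elim: k => [_|k IH kn].
  exists 0 => z z0; rewrite dotC dot0l addr0 (_ : z = 0) ?/q ?addr0//.
  by apply/rowP => i; rewrite z0// mxE.
have [y hy] := IH (ltnW kn); pose K := Ordinal kn.
have ee : (delta_mx 0 K : E) 0 K = 1 by rewrite mxE !eqxx.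
have e0 (i : 'I_n) : (k < i)%N -> (delta_mx 0 K : E) 0 i = 0.
  by rewrite mxE eqxx/= => ki; rewrite -val_eqE/= gtn_eqF.
have [|||||z|c hc] := @cvx_multiplier R E [set z | forall i : 'I_n, (k < i)%N -> z 0 i = 0]
    (fun z => q z + (dot z (- y) + - h x)) (fun z => z 0 K).
- by move=> u v t /= Du Dv _ i ki; rewrite !mxE Du// Dv// !mulr0 addr0.
- by apply: cvxD => //; exact: cvx_dot.
- by move=> u v t; rewrite !mxE.
- by exists (delta_mx 0 K) => /=; [exact: e0|rewrite ee].
- exists (- delta_mx 0 K) => /=; last by rewrite mxE ee ltrN10.
  by move=> i ki; rewrite mxE e0// oppr0.
- move=> /= Dz zK; rewrite dotC dotNl dotC.
  suff : h x + dot z y <= q z by lra.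
  apply: hy => i; rewrite leq_eqVlt => /predU1P[ki|/Dz//].
  by rewrite -zK; congr (z _ _); apply/val_inj.
- exists (y + c *: delta_mx 0 K) => z Dz; have := hc z Dz.
  have dK : dot z (delta_mx 0 K) = z 0 K.
    rewrite /dot (bigD1 K)//= ee mulr1 big1 ?addr0// => i iK.
    by rewrite mxE (negbTE iK) andbF mulr0.
  by rewrite dotDr dotZr dK (dotC z (- y)) dotNl (dotC y); lra.
Qed.

(** Jensen's inequality for a uniform average.  The subgradient at the barycentre
    gives it at once, because the affine parts of the bounds cancel. *)
Lemma cvx_average h (I : finType) (u : I -> E) (x : E) : cvx h ->
  (0 < #|I|)%N ->
  h (x + #|I|%:R^-1 *: \sum_i u i) <= #|I|%:R^-1 * \sum_i h (x + u i).
Proof.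
move=> ch I0; pose m : R := #|I|%:R; have m0 : 0 < m by rewrite ltr0n.
set p := x + m^-1 *: \sum_i u i; have [y hy] := cvx_subgradient p ch.
rewrite ler_pdivlMl//.
have : \sum_i (h p + dot (x + u i - p) y) <= \sum_i h (x + u i).
  by apply: ler_sum => i _; exact: hy.
rewrite big_split/= sumr_const -(mulr_natl (h p)) -/m.
suff -> : \sum_i dot (x + u i - p) y = 0 by rewrite addr0.
rewrite -dot_suml (_ : \sum_i _ = 0) ?dot0l//.
rewrite (eq_bigr (fun i => u i - m^-1 *: \sum_i u i)); last first.
  by move=> i _; rewrite /p opprD addrACA subrr add0r.
by rewrite sumrB sumr_const -scaler_nat scalerA mulfV ?gt_eqF// scale1r subrr.
Qed.

(** x + v is the average of the points x + n v_i e_i, and on each segment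
    [x, x + e_i] or [x, x - e_i] convexity bounds the increment of h linearly.  This
    is the upper bound; the lower one follows from 2 h(x) <= h(x+v) + h(x-v). *)
Lemma cvx_lipschitz_at h x : cvx h ->
  exists2 C, 0 <= C & forall v, `|v| * n%:R <= 1 -> `|h (x + v) - h x| <= C * `|v|.
Proof.
move=> ch.
have [n0|n0] := posnP n.
  exists 0 => // v _; rewrite (_ : v = 0) ?addr0 ?subrr ?normr0 ?mulr0//.
  by apply/rowP => -[i ilt]; exfalso; move: ilt; rewrite n0.
pose e i : E := delta_mx 0 i.
pose c := \sum_i (`|h (x + e i) - h x| + `|h (x - e i) - h x|).
have c0 : 0 <= c by apply: sumr_ge0 => i _; exact: addr_ge0.
have n0R : 0 < n%:R :> R by rewrite ltr0n.
have edge i s : `|s| <= 1 -> h (x + s *: e i) - h x <= c * `|s|.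
  move=> s1.
  have hc : h (x + s *: e i) - h x <=
      `|s| * (`|h (x + e i) - h x| + `|h (x - e i) - h x|).
    have [s0|/ltW s0] := leP 0 s.
      have s01 : 0 <= s <= 1 by rewrite s0 (le_trans (ler_norm _)).
      have := ch (x + e i) x s s01.
      rewrite scalerDr addrAC -scalerDl subrKC scale1r (ger0_norm s0).
      have k : h (x + e i) - h x <= `|h (x + e i) - h x| + `|h (x - e i) - h x|.
        by rewrite ler_wpDr// ler_norm.
      by have := ler_wpM2l s0 k; lra.
    have s01 : 0 <= - s <= 1 by rewrite oppr_ge0 s0 (le_trans (ler_norm _))// normrN.
    have := ch (x - e i) x (- s) s01.
    rewrite scalerDr addrAC -scalerDl subrKC scale1r scalerN scaleNr opprK (ler0_norm s0).
    have k : h (x - e i) - h x <= `|h (x + e i) - h x| + `|h (x - e i) - h x|.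
      by rewrite ler_wpDl// ler_norm.
    have s0' : 0 <= - s by rewrite oppr_ge0.
    by have := ler_wpM2l s0' k; lra.
  apply: le_trans hc _; rewrite mulrC ler_wpM2r// /c (bigD1 i)//= lerDl.
  by apply: sumr_ge0 => j _; exact: addr_ge0.
have up v : `|v| * n%:R <= 1 -> h (x + v) - h x <= (c * n%:R) * `|v|.
  move=> v1; have := @cvx_average h 'I_n (fun i => (n%:R * v 0 i) *: e i) x ch.
  rewrite card_ord => /(_ n0).
  rewrite (_ : n%:R^-1 *: _ = v); last first.
    rewrite [RHS]row_sum_delta scaler_sumr; apply: eq_bigr => i _.
    by rewrite scalerA mulrA mulVf ?mul1r// gt_eqF.
  move=> hv.
  have nv i : `|n%:R * v 0 i| <= n%:R * `|v|.
    by rewrite normrM normr_nat ler_wpM2l//; exact: coord_le_norm.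
  have : \sum_(i < n) (h (x + (n%:R * v 0 i) *: e i) - h x) <= \sum_(i < n) c * (n%:R * `|v|).
    apply: ler_sum => i _; apply: le_trans (edge i _ _) _.
      by apply: le_trans (nv i) _; rewrite mulrC.
    by apply: ler_wpM2l => //; exact: nv.
  rewrite sumrB !sumr_const card_ord -(mulr_natl (h x)) -(mulr_natl (c * _)).
  by rewrite ler_pdivlMl// in hv; move=> hs; rewrite -(ler_pM2l n0R); lra.
exists (c * n%:R) => [|v v1]; first exact: mulr_ge0.
rewrite ler_norml; apply/andP; split; last exact: up.
have := up (- v); rewrite normrN => /(_ v1).
have := cvx_mid (x + v) (x - v) ch.
rewrite (_ : 2^-1 *: (x + v + (x - v)) = x); first by lra.
by rewrite addrACA subrr addr0 -[x + x]mulr2n -(scaler_nat 2 x) scalerA mulVf ?pnatr_eq0// scale1r.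
Qed.

Lemma cvx_continuous h : cvx h -> continuous h.
Proof.
move=> ch x; have [C C0 hC] := cvx_lipschitz_at x ch.
apply/(@cvgrPdist_le R R E (nbhs x) (nbhs_filter x) h (h x)) => e e0.
pose d := Num.min (n.+1%:R^-1) (e / (C + 1)).
have d0 : 0 < d by rewrite lt_min invr_gt0 ltr0n/= divr_gt0//; lra.
apply: filterS (nbhsx_ballx x d d0) => z; rewrite -ball_normE /ball_/= => /ltW.
rewrite distrC le_min => /andP[z1 z2].
rewrite distrC -(subrKC x z); apply: le_trans (hC _ _) _.
  apply: le_trans (ler_wpM2r _ z1) _ => //.
  by rewrite mulrC ler_pdivrMr ?ltr0n// mul1r ler_nat.
move: z2; rewrite ler_pdivlMr; last by lra.
by move: C0 (normr_ge0 (z - x)); nra.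
Qed.

Lemma dc_continuous (v : E -> R) : dc v -> continuous v.
Proof.
move=> [h [g [ch cg vE]]] x; rewrite (_ : v = h \- g); last exact/funext.
by apply: (@cvgB _ _ _ (nbhs x) (nbhs_filter x)); [exact: (cvx_continuous ch)|exact: (cvx_continuous cg)].
Qed.

(** The function is d(x,C)^2 for the Euclidean distance: |x|^2 - d(x,C)^2 is the
    supremum over c in C of the affine functions 2<x,c> - |c|^2, hence convex. *)
Lemma closed_dc_gauge (C : set E) : closed C -> C !=set0 ->
  exists v, [/\ dc v, forall x, 0 <= v x, forall x, C x -> v x = 0 & forall x, ~ C x -> 0 < v x].
Proof.
move=> Ccl C0.
pose u (c x : E) := dot x (2 *: c) + - dot c c.
have uE c x : u c x = dot x x - dot (x - c) (x - c).
  by rewrite /u !(dotBl, dotBr, dotZr) (dotC c x); ring.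
have ub (x : E) : has_ubound [set u c x | c in C].
  by exists (dot x x) => _ [c _ <-]; rewrite uE gerBl dotxx_ge0.
pose k x := sup [set u c x | c in C].
have ck : cvx k by apply: cvx_sup => // c _; exact: cvx_dot.
have kle x : k x <= dot x x.
  apply: ge_sup; first by have [c Cc] := C0; exists (u c x), c.
  by move=> _ [c _ <-]; rewrite uE gerBl dotxx_ge0.
exists (fun x => dot x x - k x); split.
- by apply: dcB; apply: dc_cvx => //; exact: cvx_dotxx.
- by move=> x; rewrite subr_ge0.
- move=> x Cx; apply/eqP; rewrite eq_le subr_ge0 kle andbT subr_le0.
  by apply: ub_le_sup => //; exists x => //; rewrite uE subrr dot0l subr0.
- move=> x nCx; rewrite subr_gt0.
  have [e e0 Ce] : exists2 e : R, 0 < e & forall c, C c -> e <= `|x - c|.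
    have : nbhs x (~` C) by apply: open_nbhs_nbhs; split => //; exact: closed_openC.
    move=> /nbhs_ballP[e /= e0 be]; exists e => // c Cc.
    by rewrite leNgt; apply/negP => xc; apply: (be c _ Cc); rewrite -ball_normE.
  apply: (@le_lt_trans _ _ (dot x x - e ^+ 2)); last by rewrite gtrBl exprn_gt0.
  apply: ge_sup; first by have [c Cc] := C0; exists (u c x), c.
  move=> _ [c Cc <-]; rewrite uE lerB// -enorm_sqr.
  rewrite lerXn2r ?nnegrE ?enorm_ge0 ?(ltW e0)//.
  exact: le_trans (Ce _ Cc) (norm_le_enorm _).
Qed.

End Subgradient.

(** * Separation from a convex epigraph *)

Section Conjugacy.
Variables (R : realType) (n : nat).
Local Notation E := 'rV[R]_n.
Implicit Types (f g h : E -> R) (x y z : E).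

Lemma compact_norm_ball (r : R) : compact [set u : E | `|u| <= r].
Proof.
apply: bounded_closed_compact.
  exists r; split; first exact: num_real.
  by move=> M rM x /= xr; apply: le_trans xr (ltW rM).
rewrite (_ : [set u | _] = (fun u : E => `|u|) @^-1` [set t | t <= r])//.
apply: preimage_closed; last exact: closed_le.
by move=> u _; exact: norm_continuous.
Qed.

(** Think of W as the epigraph of a convex function which is at least m, and at
    least c near x0.  Only convexity of W is used, so that W may also be a Minkowski
    sum of epigraphs.  The Lipschitz regularization phi(x) = inf (s + k |x - z|), over
    (z, s) in W, is finite and convex, satisfies phi(z) <= s on W, and is at least c at
    x0 as soon as m + k d >= c.  A subgradient of phi at x0 is the slope sought. *)
Lemma epigraph_separation (W : E -> R -> Prop) (x0 : E) (m c d : R) : 0 < d ->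
  (forall z s z' s' t, W z s -> W z' s' -> 0 <= t <= 1 ->
     W (t *: z + (1 - t) *: z') (t * s + (1 - t) * s')) ->
  (forall z s, W z s -> m <= s) ->
  (forall z s, W z s -> `|x0 - z| < d -> c <= s) ->
  exists y, forall z s, W z s -> c + dot (z - x0) y <= s.
Proof.
move=> d0 cW mW cdW.
have [[z0 [s0 W0]]|noW] := pselect (exists z s, W z s); last first.
  by exists 0 => z s Wzs; exfalso; apply: noW; exists z, s.
pose k := Num.max 0 ((c - m) / d).
have k0 : 0 <= k by rewrite le_max lexx.
have kd : c <= m + k * d.
  by rewrite -lerBlDl -ler_pdivrMr// le_max lexx orbT.
pose S x := [set a | exists z s, W z s /\ a = s + k * `|x - z|].
have Si x : has_inf (S x).
  split; first by exists (s0 + k * `|x - z0|), z0, s0.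
  exists m => _ [z [s [Wzs ->]]]; apply: le_trans (mW _ _ Wzs) _.
  by rewrite lerDl mulr_ge0.
pose phi x := inf (S x).
have phi_le x z s : W z s -> phi x <= s + k * `|x - z|.
  by move=> Wzs; apply: ge_inf; [exact: (Si x).2|exists z, s].
have cphi : cvx phi.
  move=> x x' t /[dup] t01 /andP[t0 t1]; apply/ler_addgt0Pr => e e0.
  have [_ [z [s [Wzs ->]]] ze] := inf_adherent e0 (Si x).
  have [_ [z' [s' [Wzs' ->]]] ze'] := inf_adherent e0 (Si x').
  apply: le_trans (phi_le _ _ _ (cW _ _ _ _ t Wzs Wzs' t01)) _.
  have nE : `|t *: x + (1 - t) *: x' - (t *: z + (1 - t) *: z')| <=
      t * `|x - z| + (1 - t) * `|x' - z'|.
    rewrite opprD addrACA -!scalerBr; apply: le_trans (ler_normD _ _) _.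
    by rewrite !normrZ (ger0_norm t0) ger0_norm// subr_ge0.
  have t1' : 0 <= 1 - t by rewrite subr_ge0.
  have := ler_wpM2l k0 nE; have := ler_wpM2l t0 (ltW ze).
  have := ler_wpM2l t1' (ltW ze'); rewrite /phi; lra.
have phi0 : c <= phi x0.
  apply: lb_le_inf; first exact: (Si x0).1.
  move=> _ [z [s [Wzs ->]]]; have [xzd|dxz] := ltP `|x0 - z| d.
    by apply: le_trans (cdW _ _ Wzs xzd) _; rewrite lerDl mulr_ge0.
  apply: le_trans kd _; apply: lerD; first exact: mW Wzs.
  exact: ler_wpM2l.
have [y hy] := cvx_subgradient x0 cphi.
exists y => z s Wzs; have := phi_le z z s Wzs; rewrite subrr normr0 mulr0 addr0.
by have := hy z; lra.
Qed.

(** * Log-concave functions *)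

Section LCscTheory.
Variables (f : E -> R) (LCf : LCsc f).

Lemma LCsc_ge0 x : 0 <= f x.
Proof.
by have [[[_ [phi [_ _ fE]]] _] _] := LCf; rewrite -lee_fin fE expeR_ge0.
Qed.

Lemma LCsc_neq0 : exists x, 0 < f x.
Proof.
have [[[[x fx] _] _] _] := LCf; exists x.
by rewrite lt_neqAle eq_sym fx LCsc_ge0.
Qed.

Lemma LCsc_log_concave z s z' s' t : expR (- s) <= f z -> expR (- s') <= f z' ->
  0 <= t <= 1 -> expR (- (t * s + (1 - t) * s')) <= f (t *: z + (1 - t) *: z').
Proof.
have [[[_ [phi [_ cphi fE]]] _] _] := LCf.
have W x r : (expR (- r) <= f x) = (phi x <= r%:E)%E.
  by rewrite -lee_fin fE -[(expR (- r))%:E]/(expeR (- r%:E)) lee_expeR leeN2.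
rewrite !W => zs zs' /[dup] t01 /andP[t0 t1].
apply: le_trans (cphi _ _ _ t01) _; rewrite [leRHS]EFinD !EFinM.
by apply: leeD; apply: lee_wpmul2l; rewrite ?lee_fin ?subr_ge0.
Qed.

Lemma LCsc_usc x a : f x < a -> \forall z \near x, f z < a.
Proof.
have [[_ usc] _] := LCf => fxa.
have /usc : ((- a)%:E < (- f x)%:E)%E by rewrite lte_fin ltrN2.
by move=> [U Ux Ua]; apply: filterS Ux => z /Ua; rewrite lte_fin ltrN2.
Qed.

(** Super-coercivity gives the bound far away, and upper semicontinuity bounds f on
    the remaining ball, which is compact. *)
Lemma LCsc_decay (k : R) : exists C, forall x, f x <= expR (C - k * `|x|).
Proof.
wlog k0 : k / 0 <= k.
  move=> H; have [C hC] := H _ (normr_ge0 k); exists C => x.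
  by apply: le_trans (hC x) _; rewrite ler_expR lerB// ler_wpM2r// ler_norm.
have [_ /cvgeyPge/(_ k)[r _ hr]] := LCf.
pose r' := Num.max r 0.
have far x : r' < enorm x -> f x <= expR (- (k * `|x|)).
  rewrite gt_max => /andP[rx x0]; have := hr x rx.
  have [fx0 _|fx0] := leP (f x) 0; first by apply: le_trans fx0 (expR_ge0 _).
  rewrite /neglog lne_EFin// -EFinN -EFinM lee_fin ler_pdivlMr// => kx.
  rewrite -[f x]lnK ?posrE// ler_expR lerNr; apply: le_trans kx.
  by apply: ler_wpM2l => //; exact: norm_le_enorm.
have [N hN] : exists N : nat, forall x, `|x| <= r' -> f x <= N%:R.
  have := (@compact_near_coveringP E [set u : E | `|u| <= r']).1
    (@compact_norm_ball r') nat \oo (fun N x => f x <= N%:R) _.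
  case=> [x _|N _ hN]; last by exists N => x xr; exact: (hN N (leqnn N) x xr).
  have := LCsc_usc (ltr_pwDr ltr01 (lexx (f x))) => fx1.
  exists ([set z | f z < f x + 1], [set N | f x + 1 <= N%:R]) => /=.
    by split => //; exact: nbhs_infty_ger.
  by move=> [z N] /= [/ltW]; exact: le_trans.
exists (k * r' + ln (N%:R + 1)) => x.
have [xr|xr] := leP (enorm x) r'; last first.
  apply: le_trans (far _ xr) _; rewrite ler_expR lerDr; apply: addr_ge0.
    by rewrite mulr_ge0// le_max lexx orbT.
  by rewrite ln_ge0// lerDr.
have xr' := le_trans (norm_le_enorm x) xr.
apply: le_trans (hN x xr') _; apply: (@le_trans _ _ (N%:R + 1)); first by rewrite lerDl.
rewrite -[leLHS]lnK ?posrE ?ltr_wpDl// ler_expR.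
by have := ler_wpM2l k0 xr'; lra.
Qed.

End LCscTheory.

Lemma LCsc_intro f : (forall x, 0 <= f x) -> (exists x, 0 < f x) ->
  (forall z s z' s' t, expR (- s) <= f z -> expR (- s') <= f z' ->
    0 <= t <= 1 -> expR (- (t * s + (1 - t) * s')) <= f (t *: z + (1 - t) *: z')) ->
  (forall x a, f x < a -> \forall z \near x, f z < a) ->
  (forall k, 0 <= k -> exists C, forall x, f x <= expR (C - k * enorm x)) ->
  LCsc f.
Proof.
move=> f0 [x0 fx0] cf uf df.
have nE x : 0 < f x -> neglog f x = (- ln (f x))%:E.
  by move=> fx; rewrite /neglog lne_EFin.
have nE0 x : ~ 0 < f x -> neglog f x = +oo%E.
  move=> /negP; rewrite -leNgt => fx; rewrite /neglog le0_lneNy//.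
split; [split; [split|]|].
- by exists x0; rewrite gt_eqF.
- exists (neglog f); split.
  + move=> x; have [/nE ->|/nE0 ->//] := pselect (0 < f x); exact: ltNyr.
  + move=> x y t /andP[].
    rewrite le_eqVlt => /predU1P[<- _|t0].
      by rewrite scale0r add0r subr0 scale1r mul0e mul1e add0e.
    rewrite le_eqVlt => /predU1P[->|t1].
      by rewrite subrr scale0r addr0 scale1r mul0e mul1e adde0.
    have t1' : 0 < 1 - t by rewrite subr_gt0.
    have [fx|/nE0 fx] := pselect (0 < f x); have [fy|/nE0 fy] := pselect (0 < f y).
    * rewrite (nE x fx) (nE y fy) -!EFinM -EFinD.
      have := cf x (- ln (f x)) y (- ln (f y)) t.
      rewrite !opprK !lnK ?posrE// !lexx (ltW t0) (ltW t1) => /(_ isT isT isT) H.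
      have fz := lt_le_trans (expR_gt0 _) H.
      rewrite nE// lee_fin lerNl -ler_expR lnK//.
    * by rewrite fy gt0_muley ?lte_fin// (nE x fx) -EFinM addey ?leey.
    * by rewrite fx gt0_muley ?lte_fin// (nE y fy) -EFinM addye ?leey.
    * by rewrite fx fy !gt0_muley ?lte_fin// leey.
  + by move=> x; rewrite /neglog oppeK; apply/esym/eqP; rewrite lneK_eq lee_fin.
- move=> x a; rewrite lte_fin ltrNr => /uf fa; exists [set z | f z < - a] => //.
  by move=> z /= fz; rewrite lte_fin ltrNr.
- apply/cvgeyPge => A; pose k := Num.max A 0 + 1.
  have k0 : 0 <= k by rewrite addr_ge0// le_max lexx orbT.
  have [C hC] := df k k0.
  exists (Num.max C 0) => // x /=; rewrite gt_max => /andP[Cx x0'].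
  have [fx|/nE0 ->] := pselect (0 < f x); last first.
    by rewrite gt0_mulye ?leey// lte_fin invr_gt0.
  rewrite nE// -EFinM lee_fin ler_pdivlMr// lerNr -ler_expR lnK ?posrE//.
  apply: le_trans (hC x) _; rewrite ler_expR /k mulrDl mul1r.
  have Ak : A <= Num.max A 0 by rewrite le_max lexx.
  by have := ler_wpM2r (ltW x0') Ak; lra.
Qed.

End Conjugacy.

(** * Duality with finite convex functions *)

Section Duality.
Variables (R : realType) (n : nat).
Local Notation E := 'rV[R]_n.
Implicit Types (f g h : E -> R) (x y z : E).

(** The function exp (- h^* ), written as an infimum of reals so that no extended
    values occur where h^* is infinite. *)
Definition exp_conj h x : R := inf [set expR (h y - dot x y) | y in [set: E]].

Lemma exp_conj_le h x y : exp_conj h x <= expR (h y - dot x y).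
Proof.
apply: ge_inf; last by exists y.
by exists 0 => _ [z _ <-]; exact: expR_ge0.
Qed.

Lemma le_exp_conj h x c :
  (forall y, c <= expR (h y - dot x y)) -> c <= exp_conj h x.
Proof.
move=> hc; apply: lb_le_inf; first by exists (expR (h 0 - dot x 0)), 0.
by move=> _ [y _ <-].
Qed.

Lemma expR_le_exp_conj h x s :
  expR (- s) <= exp_conj h x <-> forall y, dot x y - h y <= s.
Proof.
split=> [hs y|hs]; last by apply: le_exp_conj => y; rewrite ler_expR; have := hs y; lra.
by have := le_trans hs (exp_conj_le h x y); rewrite ler_expR; lra.
Qed.

Lemma exp_conj_mono h g : (forall y, h y <= g y) ->
  forall x, exp_conj h x <= exp_conj g x.
Proof.
move=> hg x; apply: le_exp_conj => y; apply: le_trans (exp_conj_le h x y) _.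
by rewrite ler_expR lerB.
Qed.

Lemma exp_conj_ge0 h x : 0 <= exp_conj h x.
Proof. by apply: le_exp_conj => y; exact: expR_ge0. Qed.

Lemma cvx_bounded_on_ball h (k : R) : cvx h ->
  exists C, forall y, `|y| <= k -> h y <= C.
Proof.
move=> /cvx_continuous ch.
have /compact_bounded[M [_ hM]] : compact (h @` [set u : E | `|u| <= k]).
  apply: continuous_compact; last exact: compact_norm_ball.
  exact: continuous_subspaceT.
exists (M + 1) => y yk; apply: le_trans (ler_norm _) _; apply: (hM (M + 1)).
  by rewrite ltrDl.
by exists y.
Qed.

(** A subgradient of h at 0 is a point where the infimum is positive.  For
    super-coercivity, test the infimum at y = k x / |x|: this gives the bound
    exp (C - k |x|), where C bounds h on the ball of radius k. *)
Lemma LCsc_exp_conj h : cvx h -> LCsc (exp_conj h).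
Proof.
move=> ch; apply: LCsc_intro.
- exact: exp_conj_ge0.
- have [y hy] := cvx_subgradient 0 ch; exists y.
  apply: lt_le_trans (expR_gt0 (h 0)) _; apply: le_exp_conj => z.
  by rewrite ler_expR; have := hy z; rewrite subr0 (dotC y); lra.
- move=> z s z' s' t /expR_le_exp_conj zs /expR_le_exp_conj zs' /andP[t0 t1].
  apply/expR_le_exp_conj => y; rewrite dotDl !dotZl.
  have t1' : 0 <= 1 - t by rewrite subr_ge0.
  by have := ler_wpM2l t0 (zs y); have := ler_wpM2l t1' (zs' y); lra.
- move=> x a /inf_lt[|_ [y _ <-] xa]; first by exists (expR (h 0 - dot x 0)), 0.
  have cq : continuous (fun z => dot z (- y) + h y).
    by apply: cvx_continuous; exact: cvx_dot.
  have a0 := lt_trans (expR_gt0 _) xa.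
  have xla : dot x (- y) + h y < ln a.
    by rewrite -ltr_expR lnK ?posrE// dotC dotNl dotC addrC.
  have := @cvgr_lt R E (nbhs x) (nbhs_filter x) _ _ (cq x) _ xla.
  apply: filterS => z /= zla; apply: le_lt_trans (exp_conj_le h z y) _.
  by rewrite -[a]lnK ?posrE// ltr_expR; move: zla; rewrite dotC dotNl dotC; lra.
- move=> k k0; have [C hC] := cvx_bounded_on_ball k ch; exists C => x.
  have [x0|x0] := leP (enorm x) 0.
    have -> : enorm x = 0 by apply/eqP; rewrite eq_le x0 enorm_ge0.
    apply: le_trans (exp_conj_le h x 0) _; rewrite ler_expR dotC dot0l mulr0.
    by rewrite lerB// hC// normr0.
  apply: le_trans (exp_conj_le h x ((k / enorm x) *: x)) _.
  rewrite ler_expR dotZr -enorm_sqr expr2 mulrA divfK ?gt_eqF// lerB//.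
  apply: hC; rewrite normrZ ger0_norm ?divr_ge0 ?enorm_ge0//.
  by rewrite -mulrA ler_piMr// mulrC ler_pdivrMr// mul1r norm_le_enorm.
Qed.

(** The real value of the support function, which is finite on LC_n^sc
    ([suppE]). *)
Definition supp f y : R := fine (support_function f y).

Section SuppTheory.
Variables (f : E -> R) (LCf : LCsc f).

(** Bounding the support function amounts to dominating f by exponentials of affine
    functions; in this form no logarithm of 0 has to be taken. *)
Lemma support_functionP y s :
  (support_function f y <= s%:E)%E <-> forall x, f x <= expR (s - dot x y).
Proof.
have step x : ((dot x y)%:E - neglog f x <= s%:E)%E = (f x <= expR (s - dot x y)).
  rewrite /neglog oppeK; have [fx|fx] := leP (f x) 0.
    by rewrite le0_lneNy// addeNy leNye (le_trans fx (expR_ge0 _)).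
  by rewrite lne_EFin// -EFinD lee_fin -lerBrDl -[LHS]ler_expR lnK.
split=> [/ereal_supP hs x|hs]; first by rewrite -step; apply: hs; exists x.
by apply/ereal_supP => _ [x _ <-]; rewrite step.
Qed.

Lemma suppE y : support_function f y = (supp f y)%:E.
Proof.
rewrite /supp fineK//; have [x0 fx0] := LCsc_neq0 LCf.
have [C hC] := LCsc_decay LCf (\sum_(i < n) `|y 0 i|).
have le : (support_function f y <= C%:E)%E.
  apply/support_functionP => x; apply: le_trans (hC x) _.
  by rewrite ler_expR lerB// dot_le_norm.
rewrite fin_numE; apply/andP; split; last first.
  by apply: contraTneq le => ->; rewrite leye_eq.
apply: contraTneq fx0 => sN; rewrite -leNgt; apply/ler_addgt0Pr => e e0.
have /support_functionP/(_ x0) : (support_function f y <= (dot x0 y + ln e)%:E)%E.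
  by rewrite sN leNye.
by rewrite addrAC subrr add0r lnK// add0r.
Qed.

Lemma supp_leP y s : supp f y <= s <-> forall x, f x <= expR (s - dot x y).
Proof. by rewrite -lee_fin -suppE support_functionP. Qed.

Lemma le_supp x y : f x <= expR (supp f y - dot x y).
Proof. exact: (supp_leP _ _).1. Qed.

Lemma cvx_supp : cvx (supp f).
Proof.
move=> y y' t /andP[t0 t1]; apply/supp_leP => x.
have := le_supp x y; have := le_supp x y'; rewrite dotDr !dotZr.
set a := supp f y; set b := supp f y'; move: (dot x y) (dot x y') => p q fb fa.
have t1' : 0 <= 1 - t by rewrite subr_ge0.
have [ab|/ltW ba] := leP (a - p) (b - q).
  by apply: le_trans fa _; rewrite ler_expR; have := ler_wpM2l t1' ab; lra.
by apply: le_trans fb _; rewrite ler_expR; have := ler_wpM2l t0 ba; lra.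
Qed.

End SuppTheory.

(** One inequality is the definition of the infimum; the other holds because at a
    subgradient x of h at y the infimum defining [exp_conj h x] is attained at y. *)
Lemma supp_exp_conj h : cvx h -> supp (exp_conj h) = h.
Proof.
move=> ch; apply/funext => y; have LCe := LCsc_exp_conj ch.
apply/eqP; rewrite eq_le; apply/andP; split.
  by apply/(supp_leP LCe) => x; exact: exp_conj_le.
have [x hx] := cvx_subgradient y ch.
have : expR (- (dot x y - h y)) <= exp_conj h x.
  by apply/expR_le_exp_conj => z; have := hx z; rewrite dotBl !(dotC _ x); lra.
by move=> /le_trans/(_ (le_supp LCe x y)); rewrite ler_expR; lra.
Qed.

(** If the sup-convolution S were below the right-hand side at x0, let p lie strictly
    between both values.  Since f and g are upper semicontinuous and f vanishes at
    infinity, compactness makes f(u) g(w - u) <= p hold for all u and all w near x0.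
    Separating (x0, - ln p) from the sum of the epigraphs of - ln f and - ln g gives
    y with h_f(y) + h_g(y) <= <x0,y> + ln p, a contradiction. *)
Lemma exp_conj_sup_convolution f g : LCsc f -> LCsc g ->
  sup_convolution f g = exp_conj (fun y => supp f y + supp g y).
Proof.
move=> LCf LCg; apply/funext => x0.
have [C hC] := LCsc_decay LCf 1; have [D hD] := LCsc_decay LCg 0.
have {hD} gD x : g x <= expR D by rewrite -[D]subr0 -[0](mul0r `|x|).
have fC x : f x <= expR C.
  by apply: le_trans (hC x) _; rewrite ler_expR gerBl mul1r.
pose S := [set f y * g (x0 - y) | y in [set: E]].
have S0 : S !=set0 by exists (f 0 * g (x0 - 0)), 0.
have Sub : has_ubound S.
  exists (expR C * expR D) => _ [y _ <-].
  by apply: ler_pM => //; exact: LCsc_ge0.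
apply/eqP; rewrite eq_le; apply/andP; split.
  apply: ge_sup => // _ [y _ <-]; apply: le_exp_conj => w.
  apply: le_trans (ler_pM _ _ (le_supp LCf y w) (le_supp LCg (x0 - y) w)) _.
  - exact: LCsc_ge0.
  - exact: LCsc_ge0.
  - by rewrite -expRD ler_expR dotBl; lra.
rewrite leNgt; apply/negP => /midf_lt[]; set p := (_ + _) / 2 => Sp pe.
have p0 : 0 < p.
  apply: le_lt_trans Sp; apply: le_trans (ub_le_sup Sub _); last by exists 0.
  by apply: mulr_ge0; exact: LCsc_ge0.
pose c := - ln p; have cE : expR (- c) = p by rewrite opprK lnK.
have [d d0 near_le] : exists2 d, 0 < d & forall w, `|x0 - w| < d ->
    forall u, f u * g (w - u) <= p.
  pose r := C + D + c.
  have far u w : r < `|u| -> f u * g (w - u) <= p.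
    move=> ru; apply: le_trans (ler_pM _ _ (hC u) (gD (w - u))) _; try exact: LCsc_ge0.
    by rewrite -cE -expRD ler_expR mul1r; move: ru; rewrite /r; lra.
  have : nbhs x0 [set w | [set u : E | `|u| <= r] `<=` [set u | f u * g (w - u) <= p]].
    apply: ((@compact_near_coveringP E [set u : E | `|u| <= r]).1
      (@compact_norm_ball _ _ r) E (nbhs x0) (fun w u => f u * g (w - u) <= p) _) => u _.
    have fgp : f u * g (x0 - u) < p.
      by apply: le_lt_trans (ub_le_sup Sub _) Sp; exists u.
    have fu0 := LCsc_ge0 LCf u; have gu0 := LCsc_ge0 LCg (x0 - u).
    move: fgp (LCsc_usc LCf (x := u)) (LCsc_usc LCg (x := x0 - u)).
    move: (f u) (g (x0 - u)) fu0 gu0 => a b a0 b0 abp fa gb.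
    (* e <= 1 and e (a + b + 1) <= p - a b give (a + e)(b + e) <= p *)
    pose e := Num.min 1 ((p - a * b) / (a + b + 1)).
    have ab0 : 0 < a + b + 1 by lra.
    have e0 : 0 < e by rewrite lt_min ltr01 divr_gt0// subr_gt0.
    have e1 : e <= 1 by rewrite ge_min lexx.
    have ep : e * (a + b + 1) <= p - a * b.
      by rewrite -ler_pdivlMr// ge_min lexx orbT.
    have abe : (a + e) * (b + e) <= p.
      by have := ler_wpM2l (ltW e0) e1; lra.
    have /nbhs_ballP[rho /= rho0 hrho] := gb (b + e) (ltr_pwDr e0 (lexx b)).
    exists ([set u' | f u' < a + e] `&` ball u (rho / 2), ball x0 (rho / 2)).
      split => /=; last by apply: nbhsx_ballx; rewrite divr_gt0.
      apply: filterI; first by apply: fa; rewrite ltrDl.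
      by apply: nbhsx_ballx; rewrite divr_gt0.
    move=> [u' w] /= [[fu' uu'] x0w]; apply: le_trans abe.
    apply: ler_pM; [exact: LCsc_ge0|exact: LCsc_ge0|exact: ltW|apply/ltW/hrho].
    move: uu' x0w; rewrite -!ball_normE /ball_/= => uu' x0w.
    have -> : x0 - u - (w - u') = (x0 - w) - (u - u').
      by rewrite !opprB addrACA [- u - w]addrC [RHS]addrACA.
    by apply: le_lt_trans (ler_normB _ _) _; lra.
  move=> /nbhs_ballP[d /= d0 hd]; exists d => // w x0w u.
  have [ur|ru] := leP `|u| r; last exact: far.
  by apply: (hd w _ u ur); rewrite -ball_normE.
have [|||y hy] := @epigraph_separation R n
  (fun z s => exists u v a b,
     [/\ z = u + v, s = a + b, expR (- a) <= f u & expR (- b) <= g v])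
  x0 (- C - D) c d d0; last first.
- suff : supp f y + supp g y <= dot x0 y - c.
    move=> fgc; have := exp_conj_le (fun y => supp f y + supp g y) x0 y.
    apply/negP; rewrite -ltNge; apply: le_lt_trans pe.
    by rewrite -cE ler_expR; lra.
  rewrite -lerBrDr; apply/(supp_leP LCf) => u.
  have [fu|fu] := leP (f u) 0; first exact: le_trans fu (expR_ge0 _).
  suff : supp g y <= dot x0 y - c - dot u y - ln (f u).
    by move=> ?; rewrite -[f u]lnK// ler_expR; lra.
  apply/(supp_leP LCg) => v.
  have [gv|gv] := leP (g v) 0; first exact: le_trans gv (expR_ge0 _).
  rewrite -[g v]lnK// ler_expR.
  have := hy (u + v) (- ln (f u) + - ln (g v)); rewrite dotBl dotDl => H.
  suff : c + (dot u y + dot v y - dot x0 y) <= - ln (f u) + - ln (g v) by lra.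
  apply: H; exists u, v, (- ln (f u)), (- ln (g v)).
  by rewrite !opprK !lnK// !lexx.
- move=> _ _ [u [v [a [b [-> -> fa gb]]]]] x0d.
  have := near_le _ x0d u; rewrite addrAC subrr add0r -cE => fgc.
  have := le_trans (ler_pM (expR_ge0 _) (expR_ge0 _) fa gb) fgc.
  by rewrite -expRD ler_expR; lra.
- move=> z _ [u [v [a [b [_ -> fa gb]]]]].
  have := le_trans fa (fC u); have := le_trans gb (gD v); rewrite !ler_expR; lra.
- move=> _ _ _ _ t [u [v [a [b [-> -> fa gb]]]]] [u' [v' [a' [b' [-> -> fa' gb']]]]] t01.
  exists (t *: u + (1 - t) *: u'), (t *: v + (1 - t) *: v').
  exists (t * a + (1 - t) * a'), (t * b + (1 - t) * b'); split.
  + by rewrite !scalerDr addrACA.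
  + by rewrite !mulrDr addrACA.
  + exact: LCsc_log_concave.
  + exact: LCsc_log_concave.
Qed.

(** The Fenchel-Moreau theorem for f: a value p above f(x0) is, by upper
    semicontinuity, above f near x0, and separation from the epigraph of - ln f
    yields an exponential-affine majorant of f whose value at x0 is at most p. *)
Lemma exp_conj_suppE f : LCsc f -> f = exp_conj (supp f).
Proof.
move=> LCf; apply/funext => x0.
apply/eqP; rewrite eq_le; apply/andP; split.
  by apply: le_exp_conj => y; exact: le_supp.
rewrite leNgt; apply/negP => /midf_lt[]; set p := (_ + _) / 2 => Sp pe.
have p0 : 0 < p by exact: le_lt_trans (LCsc_ge0 LCf x0) Sp.
pose c := - ln p; have cE : expR (- c) = p by rewrite opprK lnK.
have /nbhs_ballP[d /= d0 hd] := LCsc_usc LCf Sp.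
have [C hC] := LCsc_decay LCf 0.
have [|||y hy] := @epigraph_separation R n (fun z s => expR (- s) <= f z)
  x0 (- C) c d d0; last first.
- suff : supp f y <= dot x0 y - c.
    move=> fc; have := exp_conj_le (supp f) x0 y.
    apply/negP; rewrite -ltNge; apply: le_lt_trans pe.
    by rewrite -cE ler_expR; lra.
  apply/(supp_leP LCf) => u.
  have [fu|fu] := leP (f u) 0; first exact: le_trans fu (expR_ge0 _).
  rewrite -[f u]lnK// ler_expR.
  by have := hy u (- ln (f u)); rewrite opprK lnK// lexx dotBl => /(_ isT); lra.
- move=> z s zs x0z; have : f z < p by apply: hd; rewrite -ball_normE.
  by move=> /(le_lt_trans zs); rewrite -cE ltr_expR; lra.
- move=> z s /le_trans/(_ (hC z)); rewrite ler_expR mul0r; lra.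
- by move=> *; exact: LCsc_log_concave.
Qed.

Lemma exp_conj_dilation f a : LCsc f -> 0 < a ->
  dilation a f = exp_conj (fun y => a * supp f y).
Proof.
move=> LCf a0; apply/funext => x; rewrite /dilation.
apply/eqP; rewrite eq_le; apply/andP; split.
  apply: le_exp_conj => y.
  apply: le_trans (ge0_ler_powR (ltW a0) _ _ (le_supp LCf (a^-1 *: x) y)) _.
  - by rewrite nnegrE LCsc_ge0.
  - by rewrite nnegrE expR_ge0.
  - by rewrite -expRM ler_expR dotZl mulrBl mulrAC mulVf ?gt_eqF// mul1r mulrC.
set q := exp_conj _ x; have q0 : 0 <= q by exact: exp_conj_ge0.
have -> : q = (q `^ a^-1) `^ a by rewrite -powRrM mulVf ?gt_eqF// powRr1.
apply: ge0_ler_powR; [exact: ltW|by rewrite nnegrE powR_ge0|by rewrite nnegrE LCsc_ge0|].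
rewrite (congr1 (@^~ (a^-1 *: x)) (exp_conj_suppE LCf)).
apply: le_exp_conj => y.
have ai0 : 0 <= a^-1 by rewrite invr_ge0 ltW.
apply: le_trans (ge0_ler_powR ai0 _ _ (exp_conj_le _ x y)) _.
- by rewrite nnegrE.
- by rewrite nnegrE expR_ge0.
- by rewrite -expRM ler_expR dotZl mulrBl mulrAC mulfV ?gt_eqF// mul1r mulrC.
Qed.

End Duality.

(** * The Daniell construction *)

(** A single enumeration e of the pairs serves all double series, so that it can be
    used both for a double family of functions and for its values under L. *)
Lemma nneseries_pair (R : realType) : exists e : nat -> nat * nat,
  forall a : nat * nat -> \bar R, (forall p, 0 <= a p)%E ->
    (\sum_(k <oo) a (e k) = \sum_(i <oo) \sum_(j <oo) a (i, j))%E.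
Proof.
have /card_esym/card_set_bijP[e be] := card_nat2.
exists e => a a0; rewrite nneseries_esumT// -(@reindex_esum _ _ _ _ _ _ _ be)//.
rewrite [RHS]nneseries_esumT; last by move=> i; exact: nneseries_ge0.
rewrite (eq_esum (b := fun i => \esum_(j in setT) a (i, j))%E); last first.
  by move=> i _; rewrite nneseries_esumT.
rewrite esum_esum// (_ : _ `*`` _ = setT); first by apply: eq_esum => -[].
by apply/seteqP; split.
Qed.

Section Daniell.
Variables (R : realType) (T : pointedType).
Variables (V : set (T -> R)) (L : (T -> R) -> R).

Definition vector_lattice_algebra := [/\ V (fun=> 1),
  forall v w, V v -> V w -> V (fun x => v x + w x),
  forall a v, V v -> V (fun x => a * v x),
  forall v w, V v -> V w -> V (fun x => v x * w x) &
  forall v, V v -> V (fun x => Num.max (v x) 0)].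

Definition positive_linear := [/\
  forall v w, V v -> V w -> L (fun x => v x + w x) = L v + L w,
  forall a v, V v -> L (fun x => a * v x) = a * L v &
  forall v, V v -> (forall x, 0 <= v x) -> 0 <= L v].

Hypotheses (VA : vector_lattice_algebra) (PL : positive_linear).

Let V1 : V (fun=> 1). Proof. by case: VA. Qed.
Let VD v w : V v -> V w -> V (fun x => v x + w x). Proof. by case: VA => _ + _ _ _; exact. Qed.
Let VZ a v : V v -> V (fun x => a * v x). Proof. by case: VA => _ _ + _ _; exact. Qed.
Let VM v w : V v -> V w -> V (fun x => v x * w x). Proof. by case: VA => _ _ _ + _; exact. Qed.
Let Vpos v : V v -> V (fun x => Num.max (v x) 0). Proof. by case: VA => _ _ _ _; exact. Qed.
Let LD v w : V v -> V w -> L (fun x => v x + w x) = L v + L w. Proof. by case: PL => + _ _; exact. Qed.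
Let LZ a v : V v -> L (fun x => a * v x) = a * L v. Proof. by case: PL => _ + _; exact. Qed.
Let L0 v : V v -> (forall x, 0 <= v x) -> 0 <= L v. Proof. by case: PL => _ _; exact. Qed.

Lemma space_cst c : V (fun=> c).
Proof. by have := VZ c V1; congr V; apply/funext => x; rewrite mulr1. Qed.

Lemma spaceB v w : V v -> V w -> V (fun x => v x - w x).
Proof.
by move=> Vv /(VZ (- 1))/(VD Vv); congr V; apply/funext => x; rewrite mulN1r.
Qed.

Lemma functionalB v w : V v -> V w -> L (fun x => v x - w x) = L v - L w.
Proof.
move=> Vv Vw; rewrite -(mulN1r (L w)) -LZ// -LD//; last exact: VZ.
by congr L; apply/funext => x; rewrite mulN1r.
Qed.

Lemma functional_le v w : V v -> V w -> (forall x, v x <= w x) -> L v <= L w.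
Proof.
move=> Vv Vw vw; rewrite -subr_ge0 -functionalB//; apply: L0; first exact: spaceB.
by move=> x; rewrite subr_ge0.
Qed.

Lemma space_min v w : V v -> V w -> V (fun x => Num.min (v x) (w x)).
Proof.
move=> Vv Vw; have := spaceB Vv (Vpos (spaceB Vv Vw)); congr V; apply/funext => x.
by case: (leP (v x) (w x)) => ?; case: (leP (v x - w x) 0) => ?; lra.
Qed.

Lemma functional0 : L (fun=> 0) = 0.
Proof.
by rewrite -[RHS](mul0r (L (fun=> 1))) -LZ//; congr L; apply/funext => x; rewrite mul0r.
Qed.

Lemma space_sum (I : Type) (r : seq I) (v : I -> T -> R) :
  (forall i, V (v i)) -> V (fun x => \sum_(i <- r) v i x).
Proof.
move=> Vv; elim: r => [|i r IH].
  by have := space_cst 0; congr V; apply/funext => x; rewrite big_nil.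
have := VD (Vv i) IH; congr V; apply/funext => x; by rewrite big_cons.
Qed.

Lemma functional_sum (I : Type) (r : seq I) (v : I -> T -> R) :
  (forall i, V (v i)) -> L (fun x => \sum_(i <- r) v i x) = \sum_(i <- r) L (v i).
Proof.
move=> Vv; elim: r => [|i r IH].
  by rewrite big_nil -[RHS]functional0; congr L; apply/funext => x; rewrite big_nil.
rewrite big_cons -IH -LD//; last exact: space_sum.
by congr L; apply/funext => x; rewrite big_cons.
Qed.

(** A set is covered by a series of nonnegative functions of V that is at least 1
    on it; with L in place of a premeasure this gives Daniell's outer measure. *)
Definition fun_cover (A : set T) (w : nat -> T -> R) := [/\ forall k, V (w k),
  forall k x, 0 <= w k x & forall x, A x -> (1 <= \sum_(k <oo) (w k x)%:E)%E].

Definition daniell_outer (A : set T) : \bar R :=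
  ereal_inf [set (\sum_(k <oo) (L (w k))%:E)%E | w in fun_cover A].

Lemma functional_cover_ge0 A w k : fun_cover A w -> (0 <= (L (w k))%:E)%E.
Proof. by move=> [Vw w0 _]; rewrite lee_fin; exact: L0. Qed.

Lemma daniell_outer_ge0 A : (0 <= daniell_outer A)%E.
Proof.
apply: le_ereal_inf_tmp => _ [w cw <-]; apply: nneseries_ge0 => k _ _.
exact: functional_cover_ge0 cw.
Qed.

Lemma daniell_outer_double_series A (w : nat -> nat -> T -> R) :
  (forall i j, V (w i j)) -> (forall i j x, 0 <= w i j x) ->
  (forall x, A x -> (1 <= \sum_(i <oo) \sum_(j <oo) (w i j x)%:E)%E) ->
  (daniell_outer A <= \sum_(i <oo) \sum_(j <oo) (L (w i j))%:E)%E.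
Proof.
move=> Vw w0 cw; have [e he] := nneseries_pair R.
rewrite -(he (fun p => (L (w p.1 p.2))%:E)); last first.
  by move=> p; rewrite lee_fin; exact: L0.
apply: ereal_inf_lbound; exists (fun k => w (e k).1 (e k).2) => //; split => //.
move=> x Ax; rewrite (he (fun p => (w p.1 p.2 x)%:E)); first exact: cw.
by move=> p; rewrite lee_fin.
Qed.

Lemma nneseries_first (a : nat -> \bar R) :
  (forall k, (0 < k)%N -> a k = 0)%E -> (0 <= a 0%N)%E -> (\sum_(k <oo) a k = a 0%N)%E.
Proof.
move=> a0 a00; rewrite nneseries_recl//; last first.
  by case=> // k _; rewrite a0.
by rewrite eseries0 ?adde0// => -[|k]// _ _; rewrite a0.
Qed.

Lemma daniell_outer_le A v : V v -> (forall x, 0 <= v x) ->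
  (forall x, A x -> 1 <= v x) -> (daniell_outer A <= (L v)%:E)%E.
Proof.
move=> Vv v0 v1; pose w k : T -> R := if k is 0%N then v else fun=> 0.
rewrite (_ : (L v)%:E = \sum_(k <oo) (L (w k))%:E)%E; last first.
  rewrite nneseries_first//=; last by rewrite lee_fin; exact: L0.
  by case=> // k _; rewrite /= functional0.
apply: ereal_inf_lbound; exists w => //; split.
- by case=> [|k] //=; exact: space_cst.
- by case.
- move=> x Ax; rewrite nneseries_first//= ?lee_fin ?v1//.
  by case.
Qed.

Lemma daniell_outer0 : daniell_outer set0 = 0%E.
Proof.
apply/eqP; rewrite eq_le daniell_outer_ge0 andbT -[leRHS]/(0%:E) -functional0.
by apply: daniell_outer_le => //; exact: space_cst.
Qed.

Lemma le_daniell_outer : {homo daniell_outer : A B / A `<=` B >-> (A <= B)%E}.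
Proof.
move=> A B AB; apply: le_ereal_inf => _ [w [Vw w0 w1] <-].
by exists w => //; split => // x /AB; exact: w1.
Qed.

Lemma daniell_outer_fin A : daniell_outer A \is a fin_num.
Proof.
rewrite ge0_fin_numE ?daniell_outer_ge0//.
by apply: le_lt_trans (daniell_outer_le (v := fun=> 1) _ _ _) (ltry _).
Qed.

Lemma daniell_outer_sigma_subadditive : sigma_subadditive daniell_outer.
Proof.
move=> A; apply/lee_addgt0Pr => e e0.
apply: le_trans (epsilon_trick xpredT (fun k => daniell_outer_ge0 (A k)) (ltW e0)).
have /choice[w hw] i : exists w, fun_cover (A i) w /\
    (\sum_(k <oo) (L (w k))%:E <= daniell_outer (A i) + (e / (2 ^ i.+1)%:R)%:E)%E.
  have ei : 0 < e / (2 ^ i.+1)%:R by rewrite divr_gt0// ltr0n expn_gt0.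
  have [_ [w cw <-] /ltW hw] := lb_ereal_inf_adherent ei (daniell_outer_fin (A i)).
  by exists w.
apply: (@le_trans _ _ (\sum_(i <oo) \sum_(j <oo) (L (w i j))%:E)%E); last first.
  apply: lee_nneseries => [i _ _|i _]; last exact: (hw i).2.
  by apply: nneseries_ge0 => k _ _; exact: functional_cover_ge0 (hw i).1.
apply: daniell_outer_double_series => [i j|i j x|x [i _ Aix]].
- by have [[]] := hw i.
- by have [[]] := hw i.
- have w0 k j : (0 <= (w k j x)%:E)%E by rewrite lee_fin; have [[]] := hw k.
  have s0 k : (0 <= \sum_(j <oo) (w k j x)%:E)%E by exact: nneseries_ge0.
  have [[_ _ /(_ x Aix) w1] _] := hw i; apply: le_trans w1 _.
  rewrite (@nneseriesD1 _ (fun i => \sum_(j <oo) (w i j x)%:E)%E i)// leeDl//; exact: nneseries_ge0.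
Qed.

HB.instance Definition _ := isOuterMeasure.Build R T daniell_outer
  daniell_outer0 daniell_outer_ge0 le_daniell_outer daniell_outer_sigma_subadditive.

(** Starting the sequence at 0 makes its increments sum to the indicator of U. *)
Definition exhausted (U : set T) := exists d : nat -> T -> R,
  [/\ forall j, V (d j), forall x, d 0%N x = 0,
      forall i j x, (i <= j)%N -> d i x <= d j x <= 1,
      forall x, ~ U x -> forall j, d j x = 0
    & forall x, U x -> d j x @[j --> \oo] --> (1 : R)].

(** Let w cover X and let e_j = d_(j+1) - d_j be the increments of the sequence that
    exhausts U.  The functions w_k e_j cover X inside U, and for each N the functions
    w_k (1 - d_N) cover X outside U.  Since w_k = sum_(j < N) w_k e_j + w_k (1 - d_N),
    the costs of both covers add up to that of w when N grows. *)
Lemma exhausted_caratheodory U : exhausted U ->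
  daniell_outer.-caratheodory U.
Proof.
move=> [d [Vd d0 dnd dU0 dU1]]; apply: le_caratheodory_measurable => X.
apply: le_ereal_inf_tmp => _ [w cw <-]; have [Vw w0 w1] := cw.
pose e j x := d j.+1 x - d j x.
have Ve j : V (e j) by exact: spaceB.
have e0 j x : 0 <= e j x by rewrite subr_ge0; case/andP: (dnd _ _ x (leqnSn j)).
have sume N x : \sum_(0 <= j < N) e j x = d N x by rewrite telescope_sumr// d0 subr0.
have Vwe j k : V (fun x => w k x * e j x) by exact: VM.
have we0 j k : (0 <= (L (fun x => w k x * e j x))%:E)%E.
  by rewrite lee_fin; apply: L0 => // x; rewrite mulr_ge0.
have wE0 x k : (0 <= (w k x)%:E)%E by rewrite lee_fin.
have inU : (daniell_outer (X `&` U) <=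
    \sum_(j <oo) \sum_(k <oo) (L (fun x => w k x * e j x))%:E)%E.
  apply: (daniell_outer_double_series (w := fun j k x => w k x * e j x)) => // [j k x|x [Xx Ux]].
    by rewrite mulr_ge0.
  apply: (@le_trans _ _ (\sum_(j <oo) (e j x)%:E)%E); last first.
    apply: lee_nneseries => [j _ _|j _]; first by rewrite lee_fin.
    rewrite (eq_eseriesr (g := fun k => ((e j x)%:E * (w k x)%:E)%E)); last first.
      by move=> k _; rewrite -EFinM mulrC.
    rewrite nneseriesZl// -[leLHS]mule1; apply: lee_wpmul2l; [by rewrite lee_fin|exact: w1].
  suff -> : (\sum_(j <oo) (e j x)%:E = 1%:E)%E by [].
  apply/cvg_lim => //; rewrite (_ : (fun N => _) = (fun N => (d N x)%:E)); last first.
    by apply/funext => N; rewrite sumEFin sume.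
  by apply: cvg_EFin; [exact: nearW|exact: dU1].
have key N : (\sum_(0 <= j < N) \sum_(k <oo) (L (fun x => w k x * e j x))%:E +
    daniell_outer (X `&` ~` U) <= \sum_(k <oo) (L (w k))%:E)%E.
  rewrite -nneseries_sum_nat//.
  have Vwd k : V (fun x => w k x * (1 - d N x)) by apply: VM => //; exact: spaceB.
  have wd0 k x : 0 <= w k x * (1 - d N x).
    by rewrite mulr_ge0// subr_ge0; case/andP: (dnd _ _ x (leqnn N)).
  apply: (@le_trans _ _ (\sum_(k <oo) \sum_(0 <= j < N) (L (fun x => w k x * e j x))%:E +
     \sum_(k <oo) (L (fun x => w k x * (1 - d N x)))%:E)%E).
    rewrite leeD2l//; apply: ereal_inf_lbound.
    exists (fun k x => w k x * (1 - d N x)) => //; split => // x [Xx nUx].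
    apply: le_trans (w1 x Xx) _.
    by apply: lee_nneseries => [//|k _]; rewrite dU0// subr0 mulr1.
  rewrite -nneseriesD; last 2 first.
  - by move=> k _ _; apply: sume_ge0.
  - by move=> k _ _; rewrite lee_fin; exact: L0.
  apply: lee_nneseries => k _.
    move=> _.
    by apply: adde_ge0; [exact: sume_ge0|rewrite lee_fin; exact: L0].
  rewrite sumEFin -EFinD lee_fin -functional_sum// -LD//; last exact: space_sum.
  apply: functional_le => //; first by apply: VD => //; exact: space_sum.
  by move=> x; rewrite -mulr_sumr sume -mulrDr subrKC mulr1.
rewrite -leeBrDr ?daniell_outer_fin//; apply: le_trans inU _.
apply: lime_le; first by apply: is_cvg_nneseries => j _ _; exact: nneseries_ge0.
by apply: nearW => N; rewrite leeBrDr ?daniell_outer_fin.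
Qed.

Variable G : set (set T).
Local Notation S := (g_sigma_algebraType G).
Hypotheses (GV : forall U, G U -> exhausted U)
  (mV : forall v, V v -> measurable_fun [set: S] (v : S -> R))
  (Lsigma : forall w : nat -> T -> R, (forall k, V (w k)) ->
     (forall k x, 0 <= w k x) -> (forall x, (1 <= \sum_(k <oo) (w k x)%:E)%E) ->
     ((L (fun=> 1))%:E <= \sum_(k <oo) (L (w k))%:E)%E).

Definition daniell_measure (A : set S) : \bar R := daniell_outer A.

Lemma g_sigma_caratheodory (A : set S) : measurable A -> daniell_outer.-caratheodory A.
Proof.
apply: smallest_sub => [|U /GV]; last exact: exhausted_caratheodory.
split.
- exact: caratheodory_measurable_set0.
- by move=> B mB; rewrite setTD; exact: caratheodory_measurable_setC.
- by move=> B mB; exact: caratheodory_measurable_bigcup.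
Qed.

Let daniell_measure0 : daniell_measure set0 = 0%E.
Proof. exact: daniell_outer0. Qed.

Let daniell_measure_ge0 A : (0 <= daniell_measure A)%E.
Proof. exact: daniell_outer_ge0. Qed.

Let daniell_measure_sigma_additive : semi_sigma_additive daniell_measure.
Proof.
move=> A mA tA mUA.
have := @caratheodory_measure_sigma_additive R T daniell_outer A.
by apply => // [i|]; exact: g_sigma_caratheodory.
Qed.

HB.instance Definition _ := isMeasure.Build _ S R daniell_measure
  daniell_measure0 daniell_measure_ge0 daniell_measure_sigma_additive.

Local Notation m := (daniell_measure : {measure set S -> \bar R}).

Lemma daniell_measureT : m setT = (L (fun=> 1))%:E.
Proof.
apply/eqP; rewrite eq_le; apply/andP; split.
  by apply: daniell_outer_le.
apply: le_ereal_inf_tmp => _ [w [Vw w0 w1] <-].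
by apply: Lsigma => // x; exact: w1.
Qed.

Lemma measurable_EFin_space v : V v -> measurable_fun [set: S] (EFin \o (v : S -> R)).
Proof. by move=> Vv; apply/measurable_EFinP; exact: mV. Qed.

(** Slice v at the levels a_i = i / N.  The slice t_i = min (v, a_(i+1)) - min (v, a_i)
    satisfies N t_i >= 1 where v >= a_(i+1), so N L(t_i) bounds the measure of that
    set, while v <= 1/N + sum_i 1_(v >= a_(i+1)) / N.  Summing, the integral of v is at
    most L(1) / N + L(v). *)
Lemma integral_le_unit v : V v -> (forall x, 0 <= v x <= 1) ->
  (\int[m]_x (v x)%:E <= (L v)%:E)%E.
Proof.
move=> Vv v01; apply/lee_addgt0Pr => e e0.
have L10 : 0 <= L (fun=> 1) by exact: L0.
pose N := (Num.truncn (L (fun=> 1) / e)).+1.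
have NR0 : 0 < N%:R :> R by rewrite ltr0n.
have NL : L (fun=> 1) / N%:R <= e.
  by rewrite ler_pdivrMr// mulrC -ler_pdivrMr// ltW// truncnS_gt.
pose a i : R := i%:R / N%:R.
have a0 i : 0 <= a i by rewrite divr_ge0.
have aS i : a i.+1 = a i + N%:R^-1 by rewrite /a -natr1 mulrDl mul1r.
pose A i := [set x : S | a i.+1 <= v x].
pose t i x := Num.min (v x) (a i.+1) - Num.min (v x) (a i).
have Vt i : V (t i) by apply: spaceB; apply: space_min => //; exact: space_cst.
have mA i : measurable (A i).
  rewrite (_ : A i = [set: S] `&` v @^-1` `[a i.+1, +oo[%classic).
    by apply: mV => //; exact: measurable_itv.
  by rewrite setTI; apply/seteqP; split => x /=; rewrite in_itv/= andbT.
have iA i : (m (A i) <= (N%:R * L (t i))%:E)%E.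
  rewrite -LZ//; apply: daniell_outer_le; first exact: VZ.
    move=> x; apply: mulr_ge0 => //; rewrite /t.
    have := aS i; have : 0 < N%:R^-1 :> R by [rewrite invr_gt0].
    by case: (leP (v x) (a i.+1)); case: (leP (v x) (a i)); lra.
  move=> x Ax; rewrite /t (min_r Ax) (@min_r _ _ (v x) (a i)); last first.
    by apply: le_trans Ax; rewrite aS lerDl invr_ge0.
  by rewrite aS addrAC subrr add0r mulfV// gt_eqF.
have indA i x : \1_(A i) x = (a i.+1 <= v x)%R%:R :> R.
  by rewrite indicE; congr (nat_of_bool _)%:R; apply/idP/idP; rewrite inE.
have step x j : Num.min (v x) (a j.+1) <= N%:R^-1 + \sum_(i < j) N%:R^-1 * \1_(A i) x.
  elim: j => [|j IH].
    by rewrite big_ord0 addr0 ge_min aS /a mul0r add0r lexx orbT.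
  rewrite big_ord_recr/= addrA indA; case: (leP (a j.+1) (v x)) => [av|va].
    move: IH; rewrite (min_r av) mulr1 => IH.
    by apply: (@le_trans _ _ (a j.+2)); [rewrite ge_min lexx orbT|rewrite aS lerD].
  rewrite mulr0 addr0; apply: le_trans IH; rewrite (min_l (ltW va)) min_l//.
  by apply: ltW (lt_trans va _); rewrite (aS j.+1) ltrDl invr_gt0.
have vle x : v x <= N%:R^-1 + \sum_(i < N) N%:R^-1 * \1_(A i) x.
  apply: le_trans (step x N); rewrite min_l// aS /a mulfV ?gt_eqF//.
  by have /andP[_ v1] := v01 x; apply: le_trans v1 _; rewrite lerDl invr_ge0.
have Nge0 : 0 <= N%:R^-1 :> R by rewrite invr_ge0.
have mind i : measurable_fun [set: S] (fun x : S => (N%:R^-1%:E * (\1_(A i) x)%:E)%E).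
  by apply: measurable_funeM; apply/measurable_EFinP; exact: measurable_indic.
have ind0 i (x : S) : (0 <= N%:R^-1%:E * (\1_(A i) x)%:E :> \bar R)%E.
  by rewrite -EFinM lee_fin mulr_ge0.
apply: (@le_trans _ _ (\int[m]_x (N%:R^-1%:E + \sum_(i < N) (N%:R^-1%:E * (\1_(A i) x)%:E)))%E).
  apply: ge0_le_integral => //.
  - by move=> x _; rewrite lee_fin; case/andP: (v01 x).
  - exact: measurable_EFin_space.
  - by apply: emeasurable_funD => //; exact: emeasurable_sum.
  - move=> x _; rewrite (eq_bigr (fun i : 'I_N => (N%:R^-1 * \1_(A i) x)%:E)) ?sumEFin//.
    by rewrite -EFinD lee_fin.
rewrite ge0_integralD//; last 2 first.
- by move=> x _; exact: sume_ge0.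
- exact: emeasurable_sum.
rewrite ge0_integral_sum// (eq_bigr (fun i : 'I_N => (N%:R^-1%:E * m (A i))%E)); last first.
  move=> i _; rewrite ge0_integralZl_EFin//.
  - by rewrite integral_indic// setIT.
  - by apply/measurable_EFinP; exact: measurable_indic.
rewrite integral_cst// daniell_measureT addeC; apply: leeD; last first.
  by rewrite -EFinM lee_fin mulrC.
apply: (@le_trans _ _ (\sum_(i < N) (L (t i))%:E)%E).
  apply: lee_sum => i _; apply: le_trans (lee_wpmul2l _ (iA i)) _ => //.
  by rewrite -EFinM lee_fin mulrA mulVf ?mul1r// gt_eqF.
rewrite sumEFin lee_fin -functional_sum//; apply: functional_le => //; first exact: space_sum.
move=> x; rewrite -(big_mkord xpredT (fun i => t i x)) telescope_sumr//.
rewrite /a mul0r mulfV ?gt_eqF// lerBlDr (@min_r _ _ _ 0) ?addr0 ?ge_min ?lexx//.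
by case/andP: (v01 x).
Qed.

(** The upper bound for v and the one for 1 - v add up to an equality. *)
Lemma integral_unit v : V v -> (forall x, 0 <= v x <= 1) ->
  (\int[m]_x (v x)%:E = (L v)%:E)%E.
Proof.
move=> Vv v01; apply/eqP; rewrite eq_le integral_le_unit//=.
have Vv' : V (fun x => 1 - v x) by exact: spaceB.
have v01' x : 0 <= 1 - v x <= 1 by have := v01 x; lra.
have := integral_le_unit Vv' v01'; rewrite functionalB//.
have : (\int[m]_x (v x)%:E + \int[m]_x (1 - v x)%:E = (L (fun=> 1))%:E)%E.
  rewrite -ge0_integralD//.
  - rewrite -daniell_measureT -[RHS]mul1e -integral_cst//.
    by apply: eq_integral => x _; rewrite -EFinD subrKC.
  - by move=> x _; rewrite lee_fin; case/andP: (v01 x).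
  - exact: measurable_EFin_space.
  - by move=> x _; rewrite lee_fin; case/andP: (v01' x).
  - exact: measurable_EFin_space.
have : (0 <= \int[m]_x (v x)%:E)%E.
  by apply: integral_ge0 => x _; rewrite lee_fin; case/andP: (v01 x).
have : (0 <= \int[m]_x (1 - v x)%:E)%E.
  by apply: integral_ge0 => x _; rewrite lee_fin; case/andP: (v01' x).
case: (integral _ _ _) => [p| |]; case: (integral _ _ _) => [q| |]//.
by rewrite !lee_fin => _ _ [pq]; lra.
Qed.

Lemma integral_bounded v c : V v -> 0 < c -> (forall x, 0 <= v x <= c) ->
  (\int[m]_x (v x)%:E = (L v)%:E)%E.
Proof.
move=> Vv c0 vc; have Vv' := VZ c^-1 Vv.
have v01 x : 0 <= c^-1 * v x <= 1.
  have /andP[v0 v1] := vc x; rewrite mulr_ge0 ?invr_ge0 ?(ltW c0)//=.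
  by rewrite mulrC ler_pdivrMr// mul1r.
have cc : c != 0 by rewrite gt_eqF.
have := integral_unit Vv' v01; rewrite LZ// EFinM => H.
have -> : (L v)%:E = (c%:E * (c^-1%:E * (L v)%:E))%E.
  by rewrite -!EFinM mulrA mulfV// mul1r.
rewrite -H -ge0_integralZl_EFin ?(ltW c0)//.
- by apply: eq_integral => x _; rewrite -EFinM mulrA mulfV// mul1r.
- by move=> x _; rewrite lee_fin; case/andP: (v01 x).
- exact: measurable_EFin_space.
Qed.

(** Truncate: (v - N)^+ <= v^2 / N, and v^2 belongs to V, so L (min (v, N)) tends to
    L v without any further continuity of L. *)
Lemma integral_space_ge0 v : V v -> (forall x, 0 <= v x) ->
  (\int[m]_x (v x)%:E = (L v)%:E)%E.
Proof.
move=> Vv v0.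
pose u N x := Num.min (v x) N.+1%:R.
have Vu N : V (u N) by apply: space_min => //; exact: space_cst.
have u0 N x : 0 <= u N x by rewrite le_min v0/=.
have iu N : (\int[m]_x (u N x)%:E = (L (u N))%:E)%E.
  apply: (@integral_bounded _ N.+1%:R) => // x.
  by rewrite u0 ge_min lexx orbT.
have Lu N : L v - L (fun x => v x * v x) / N.+1%:R <= L (u N).
  rewrite mulrC -LZ; last exact: VM.
  rewrite -functionalB//; last by apply: VZ; exact: VM.
  apply: functional_le => //; first by apply: spaceB => //; apply: VZ; exact: VM.
  move=> x; rewrite /u le_min gerBl mulr_ge0 ?invr_ge0 ?mulr_ge0//=.
  have N0 : 0 < N.+1%:R :> R by rewrite ltr0n.
  rewrite -(ler_pM2l N0) mulrBr [X in _ - X]mulrA mulfV ?gt_eqF// mul1r.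
  by have := sqr_ge0 (v x - N.+1%:R); have := sqr_ge0 (v x); have := sqr_ge0 (N.+1%:R : R); lra.
apply/eqP; rewrite eq_le; apply/andP; split.
  have cu : (\int[m]_x (u N x)%:E @[N --> \oo] --> \int[m]_x (v x)%:E)%E.
    have E x : (v x)%:E = limn (fun N => (u N x)%:E).
      apply/esym/cvg_lim => //; apply: cvg_near_cst.
      exists (Num.truncn (v x)) => // N /= vN; rewrite /u min_l//.
      by apply: ltW; apply: lt_le_trans (truncnS_gt _) _; rewrite ler_nat.
    rewrite (_ : \int[m]_x (v x)%:E = \int[m]_x limn (fun N => (u N x)%:E))%E; last first.
      by apply: eq_integral => x _; rewrite E.
    apply: cvg_monotone_convergence => //.
    - by move=> N; exact: measurable_EFin_space.
    - by move=> N x _; rewrite lee_fin.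
    - move=> x _ i j ij; rewrite lee_fin /u le_min ge_min lexx/= ge_min.
      by rewrite ler_nat ltnS ij orbT.
  rewrite -(cvg_lim _ cu)//; apply: lime_le; first by apply/cvg_ex; eexists; exact: cu.
  apply: nearW => N; rewrite iu lee_fin; apply: functional_le => // x.
  by rewrite ge_min lexx.
apply/lee_addgt0Pr => e e0.
set q := L (fun x => v x * v x) in Lu.
have q0 : 0 <= q by apply: L0; [exact: VM|move=> x; rewrite mulr_ge0].
pose N := Num.truncn (q / e).
have Nq : q / N.+1%:R <= e.
  by rewrite ler_pdivrMr ?ltr0n// mulrC -ler_pdivrMr// ltW// truncnS_gt.
apply: (@le_trans _ _ ((L (u N))%:E + e%:E)%E).
  rewrite -EFinD lee_fin -lerBlDr; apply: le_trans (Lu N).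
  by rewrite lerB.
rewrite -iu leeD2r//; apply: ge0_le_integral => //.
- by move=> x _; rewrite lee_fin.
- exact: measurable_EFin_space.
- exact: measurable_EFin_space.
- by move=> x _; rewrite lee_fin ge_min lexx.
Qed.

Theorem daniell_representation :
  exists mu : {measure set S -> \bar R}, (mu setT < +oo)%E /\
    forall v, V v -> (\int[mu]_x (v x)%:E = (L v)%:E)%E.
Proof.
exists m; split; first by rewrite daniell_measureT ltry.
move=> v Vv.
have VN : V (fun x => - v x) by have := VZ (- 1) Vv; congr V; apply/funext => x; rewrite mulN1r.
have Vp := Vpos Vv; have Vn := Vpos VN.
rewrite integralE.
have -> : (\int[m]_x ((fun x => (v x)%:E)^\+ x) = (L (fun x => Num.max (v x) 0))%:E)%E.
  rewrite -integral_space_ge0//; last by move=> x; rewrite le_max lexx orbT.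
  by apply: eq_integral => x _; rewrite funeposE EFin_max.
have -> : (\int[m]_x ((fun x => (v x)%:E)^\- x) = (L (fun x => Num.max (- v x) 0))%:E)%E.
  rewrite -integral_space_ge0//; last by move=> x; rewrite le_max lexx orbT.
  by apply: eq_integral => x _; rewrite funenegE EFin_max.
rewrite -EFinD -functionalB//; congr (L _)%:E; apply/funext => x.
by case: (leP (v x) 0) => ?; case: (leP (- v x) 0) => ?; lra.
Qed.

End Daniell.

(** * Monotone linear functionals on convex functions *)

Section ConvexFunctionals.
Variables (R : realType) (n : nat).
Local Notation E := 'rV[R]_n.
Local Notation B := (borelE R n).
Implicit Types (h g v : E -> R).

Lemma continuous_borel_measurable v : continuous v -> measurable_fun [set: B] (v : B -> R).
Proof.
move=> /continuousP cv; apply: (measurability _ (RGenOpens.measurableE R)).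
move=> _ [_ [a [b ->] <-]]; rewrite setTI; apply: sub_sigma_algebra.
exact/cv/interval_open.
Qed.

Lemma dc_measurable v : dc v -> measurable_fun [set: B] (v : B -> R).
Proof. by move=> dv; apply: continuous_borel_measurable; exact: (dc_continuous dv). Qed.

Lemma dc_vector_lattice : vector_lattice_algebra (@dc R E).
Proof.
split.
- exact: dc_cst.
- by move=> v w; exact: dcD.
- by move=> a v; exact: dcZ.
- by move=> v w; exact: dcM.
- by move=> v; exact: dc_pos.
Qed.

(** Take the truncations min (1, j v) with v the squared distance to the
    complement. *)
Lemma open_dc_exhausted (U : set E) : open U -> exhausted (@dc R E) U.
Proof.
move=> oU.
have [v [dv v0 vC vU]] : exists v, [/\ dc v, forall x, 0 <= v x,
    forall x, ~ U x -> v x = 0 & forall x, U x -> 0 < v x].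
  have [C0|C0] := pselect (~` U !=set0); last first.
    exists (fun=> 1); split => //; first exact: dc_cst.
    by move=> x nUx; exfalso; apply: C0; exists x.
  have [v [dv v0 v1 v2]] := closed_dc_gauge (open_closedC oU) C0.
  by exists v; split => // y Uy; apply: v2; rewrite /setC/= notK.
exists (fun j y => Num.min 1 (j%:R * v y)); split.
- by move=> j; apply: dc_min; [exact: dc_cst|exact: dcZ].
- by move=> y; rewrite mul0r min_r.
- move=> i j y ij; apply/andP; split; last by rewrite ge_min lexx.
  by rewrite le_min !ge_min lexx/= ler_wpM2r ?ler_nat// orbT.
- by move=> y nUy j; rewrite vC// mulr0 min_r.
- move=> y Uy; apply: cvg_near_cst; exists (Num.truncn (v y)^-1).+1 => // j /= vj.
  rewrite min_l// -ler_pdivrMr ?vU// mul1r; apply: ltW.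
  by apply: lt_le_trans (truncnS_gt _) _; rewrite ler_nat.
Qed.

Definition cone_linear (G : (E -> R) -> R) := forall h g a b,
  cvx h -> cvx g -> 0 < a -> 0 < b ->
  G (fun y => a * h y + b * g y) = a * G h + b * G g.

Definition cone_monotone (G : (E -> R) -> R) := forall h g,
  cvx h -> cvx g -> (forall y, h y <= g y) -> G h <= G g.

Section Extension.
Variable G : (E -> R) -> R.
Hypotheses (Glin : cone_linear G) (Gmono : cone_monotone G).

Lemma cone_functionalD h g : cvx h -> cvx g -> G (fun y => h y + g y) = G h + G g.
Proof.
move=> ch cg; have := Glin ch cg ltr01 ltr01; rewrite !mul1r => <-.
by congr G; apply/funext => y; rewrite !mul1r.
Qed.

Lemma cone_functional0 : G (fun=> 0) = 0.
Proof.
have c0 := @cvx_cst R E 0.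
have := cone_functionalD c0 c0; rewrite (_ : (fun=> 0 + 0) = (fun=> 0)); first by lra.
by apply/funext => y; rewrite addr0.
Qed.

Lemma cone_functionalZ h a : 0 <= a -> cvx h -> G (fun y => a * h y) = a * G h.
Proof.
rewrite le_eqVlt => /predU1P[<- _|a0 ch].
  by rewrite mul0r -[RHS]cone_functional0; congr G; apply/funext => y; rewrite mul0r.
have a20 : 0 < a / 2 by rewrite divr_gt0.
have := Glin ch ch a20 a20; rewrite -mulrDl -splitr => <-.
by congr G; apply/funext => y; rewrite -mulrDl -splitr.
Qed.

(** L (h - g) = G h - G g is well defined because h - g = h' - g' means
    h + g' = h' + g, and G is additive. *)
Lemma cone_extension : exists L : (E -> R) -> R, positive_linear (@dc R E) L /\
  forall h, cvx h -> L h = G h.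
Proof.
have /choice[L hL] v : exists r, forall h g, cvx h -> cvx g ->
    (forall x, v x = h x - g x) -> r = G h - G g.
  have [[h [g [ch cg vE]]]|ndc] := pselect (dc v); last first.
    by exists 0 => h g ch cg vE; exfalso; apply: ndc; exists h, g.
  exists (G h - G g) => h' g' ch' cg' vE'.
  suff : G h + G g' = G h' + G g by lra.
  rewrite -!cone_functionalD//; congr G; apply/funext => x.
  by have := vE x; rewrite vE'; lra.
exists L; split; last first.
  move=> h ch; rewrite (hL h h (fun=> 0)) ?cone_functional0 ?subr0//; first exact: cvx_cst.
  by move=> x; rewrite subr0.
split.
- move=> v w [h [g [ch cg vE]]] [h' [g' [ch' cg' wE]]].
  rewrite (hL v h g)// (hL w h' g')// (hL _ (fun x => h x + h' x) (fun x => g x + g' x)).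
  + by rewrite !cone_functionalD//; lra.
  + exact: cvxD.
  + exact: cvxD.
  + by move=> x; rewrite vE wE; lra.
- move=> a v [h [g [ch cg vE]]]; rewrite (hL v h g)//.
  have [a0|/ltW a0] := leP 0 a.
    rewrite (hL _ (fun x => a * h x) (fun x => a * g x)) ?cone_functionalZ//; first by lra.
    + exact: cvxZ.
    + exact: cvxZ.
    + by move=> x; rewrite vE; lra.
  have na0 : 0 <= - a by lra.
  rewrite (hL _ (fun x => - a * g x) (fun x => - a * h x)) ?cone_functionalZ//; first by lra.
  + exact: cvxZ.
  + exact: cvxZ.
  + by move=> x; rewrite vE; lra.
- move=> v [h [g [ch cg vE]]] v0; rewrite (hL v h g)// subr_ge0; apply: Gmono => // x.
  by have := v0 x; rewrite vE; lra.
Qed.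

End Extension.

Section Dini.
Variable L : (E -> R) -> R.
Hypothesis PL : positive_linear (@dc R E) L.

(** By Dini's theorem some partial sum is at least 1 - e on the ball of radius 1/e.
    Outside that ball 1 <= e |x|, so 1 is at most that partial sum plus e + e |x|
    everywhere, and L of the last two terms is of order e. *)
Lemma dc_functional_series (w : nat -> E -> R) : (forall k, dc (w k)) ->
  (forall k x, 0 <= w k x) -> (forall x, (1 <= \sum_(k <oo) (w k x)%:E)%E) ->
  ((L (fun=> 1))%:E <= \sum_(k <oo) (L (w k))%:E)%E.
Proof.
move=> dw w0 w1; apply/lee_addgt0Pr => e0 e00.
have VA := dc_vector_lattice.
have d1 : dc (fun=> 1 : R) := @dc_cst R E 1.
have dn : dc (fun x : E => `|x|) := dc_cvx (@cvx_norm R E).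
have [LD LZ L0] := PL.
have L10 : 0 <= L (fun=> 1) by exact: L0.
have Ln0 : 0 <= L (fun x : E => `|x|) by exact: L0.
pose C := L (fun=> 1) + L (fun x : E => `|x|) + 1.
have C0 : 0 < C by rewrite /C; lra.
pose e := e0 / C; have e_gt0 : 0 < e by rewrite divr_gt0.
pose s N (x : E) := \sum_(0 <= k < N) w k x.
have ds N : dc (s N) by exact: space_sum.
have s_nd N M x : (N <= M)%N -> s N x <= s M x.
  by move=> NM; rewrite /s (big_cat_nat _ NM)//= lerDl sumr_ge0.
have : \forall N \near \oo, [set x : E | `|x| <= e^-1] `<=` [set x | 1 - e <= s N x].
  apply: ((@compact_near_coveringP E _).1 (@compact_norm_ball R n e^-1) nat \oo
    (fun N x => 1 - e <= s N x)) => x _.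
  have [N sN] : exists N, 1 - e < s N x.
    apply: contrapT => /forallNP H.
    suff : (\sum_(k <oo) (w k x)%:E <= (1 - e)%:E)%E.
      by move=> /(le_trans (w1 x)); rewrite lee_fin; lra.
    apply: lime_le; first by apply: is_cvg_nneseries => k _ _; rewrite lee_fin.
    by apply: nearW => N; rewrite sumEFin lee_fin leNgt; apply/negP/H.
  have cs := dc_continuous (ds N).
  have nx := @cvgr_gt R E (nbhs x) (nbhs_filter x) _ _ (cs x) _ sN.
  exists ([set x' | 1 - e < s N x'], [set M | (N <= M)%N]) => /=.
    by split; [exact: nx|exact: nbhs_infty_ge].
  by move=> [x' M] /= [/ltW sx' NM]; apply: le_trans sx' _; exact: s_nd.
move=> [N _ /(_ N (leqnn N)) hN].
have le1 (x : E) : 1 <= s N x + (e * 1 + e * `|x|).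
  have s0 : 0 <= s N x by exact: sumr_ge0.
  have [xe|ex] := leP `|x| e^-1.
    have /= := hN x xe; have := mulr_ge0 (ltW e_gt0) (normr_ge0 x); lra.
  have : 1 <= e * `|x|.
    by rewrite -(mulfV (lt0r_neq0 e_gt0)); apply: ler_wpM2l; exact: ltW.
  lra.
have de : dc (fun x : E => e * 1 + e * `|x|) by apply: dcD; exact: dcZ.
have := functional_le VA PL d1 (dcD (ds N) de) le1.
rewrite LD// LD; [|exact: dcZ|exact: dcZ]; rewrite !LZ// => H.
apply: (@le_trans _ _ ((L (s N))%:E + e0%:E)%E).
  rewrite -EFinD lee_fin; apply: le_trans H _; rewrite lerD2l -mulrDr.
  by rewrite /e mulrAC ler_pdivrMr// ler_wpM2l// ?(ltW e00)// /C; lra.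
rewrite leeD2r// /s (functional_sum VA PL)// -sumEFin.
by apply: nneseries_lim_ge => k _ _; rewrite lee_fin; exact: L0.
Qed.

Lemma dc_representation :
  exists mu : {measure set B -> \bar R}, (mu setT < +oo)%E /\
    forall v, dc v -> (\int[mu]_x (v x)%:E = (L v)%:E)%E.
Proof.
apply: (daniell_representation dc_vector_lattice PL).
- exact: open_dc_exhausted.
- exact: dc_measurable.
- exact: dc_functional_series.
Qed.

End Dini.
End ConvexFunctionals.

(** * Uniqueness and compactness of the support *)

Section SupportUniqueness.
Variables (R : realType) (n : nat).
Local Notation E := 'rV[R]_n.
Local Notation B := (borelE R n).
Implicit Types (h g v : E -> R) (mu nu : {measure set B -> \bar R}).

Lemma measurable_EFin_dc v : dc v -> measurable_fun [set: B] (EFin \o (v : B -> R)).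
Proof. by move=> dv; apply/measurable_EFinP; exact: dc_measurable. Qed.

Lemma open_borel (U : set E) : open U -> measurable (U : set B).
Proof. by move=> oU; exact: sub_sigma_algebra. Qed.

(** Writing v = h - g with h and g nonnegative allows the integrals of v to be
    obtained by subtracting finite quantities. *)
Lemma integral_dc_unique mu nu :
  (forall h, cvx h -> (\int[mu]_x (h x)%:E)%E \is a fin_num) ->
  (forall h, cvx h -> (\int[mu]_x (h x)%:E = \int[nu]_x (h x)%:E)%E) ->
  forall v, dc v -> (forall x, 0 <= v x) ->
  (\int[mu]_x (v x)%:E = \int[nu]_x (v x)%:E)%E.
Proof.
move=> mufin munu v dv v0; have [h [g [ch cg h0 g0 vE]]] := dc_nneg dv.
have sum_eq (m : {measure set B -> \bar R}) :
    (\int[m]_x (v x)%:E + \int[m]_x (g x)%:E = \int[m]_x (h x)%:E)%E.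
  rewrite -ge0_integralD//.
  - by apply: eq_integral => x _; rewrite -EFinD vE subrK.
  - by move=> x _; rewrite lee_fin.
  - exact: measurable_EFin_dc.
  - by move=> x _; rewrite lee_fin.
  - by apply: measurable_EFin_dc; exact: dc_cvx.
have gfin : (\int[nu]_x (g x)%:E)%E \is a fin_num by rewrite -munu//; exact: mufin.
have := sum_eq mu; rewrite (munu h ch) (munu g cg) -sum_eq.
by move=> /(congr1 (fun z => z - \int[nu]_x (g x)%:E)%E); rewrite !addeK.
Qed.

(** Open sets form a pi-system, and their indicators are increasing limits of
    differences of convex functions. *)
Lemma integral_dc_measure_unique mu nu : (mu setT < +oo)%E ->
  (forall v, dc v -> (forall x, 0 <= v x) ->
    (\int[mu]_x (v x)%:E = \int[nu]_x (v x)%:E)%E) ->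
  forall A : set B, measurable A -> mu A = nu A.
Proof.
move=> mufin munu.
have indic_cvg (m : {measure set B -> \bar R}) (U : set E) (d : nat -> E -> R) :
    open U -> (forall j, dc (d j)) ->
    (forall j x, 0 <= d j x) -> (forall i j x, (i <= j)%N -> d i x <= d j x) ->
    (forall x, d j x @[j --> \oo] --> (\1_U x : R)) ->
    (\int[m]_x (d j x)%:E)%E @[j --> \oo] --> m U.
  move=> oU dd d0 dnd dU.
  rewrite (_ : m U = \int[m]_x limn (fun j => (d j x)%:E))%E; last first.
    transitivity (\int[m]_x (\1_U x)%:E)%E.
      by rewrite integral_indic ?setIT//; exact: open_borel.
    apply: eq_integral => x _; apply/esym/cvg_lim => //.
    by apply: cvg_EFin; [exact: nearW|exact: dU].
  apply: cvg_monotone_convergence => //.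
  - by move=> j; exact: measurable_EFin_dc.
  - by move=> j x _; rewrite lee_fin.
  - by move=> x _ i j ij; rewrite lee_fin dnd.
move=> A mA.
apply: (@measure_unique _ R B (@open E) (fun=> [set: E]) erefl _ _ _ mu nu _ _ A mA) => //.
- exact: openI.
- by move=> i; exact: openT.
- by apply/seteqP; split => // x _; exists 0%N.
move=> U oU; have [d [dd d0 dnd dU0 dU1]] := open_dc_exhausted oU.
have d_ge0 j x : 0 <= d j x.
  by rewrite -(d0 x); case/andP: (dnd 0%N j x (leq0n j)).
have d_nd i j x : (i <= j)%N -> d i x <= d j x by case/(dnd _ _ x)/andP.
have d_cvg x : d j x @[j --> \oo] --> (\1_U x : R).
  have [Ux|nUx] := pselect (U x); first by rewrite indicE mem_set//; exact: dU1.
  rewrite indicE memNset//; apply: cvg_near_cst; apply: nearW => j; exact: dU0.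
have cmu := indic_cvg mu U d oU dd d_ge0 d_nd d_cvg.
have cnu := indic_cvg nu U d oU dd d_ge0 d_nd d_cvg.
rewrite -(cvg_lim _ cmu)// -(cvg_lim _ cnu)//; congr (lim (_ @ \oo)).
by apply/funext => j; exact: munu.
Qed.

Lemma closed_measure_support mu : closed (measure_support mu).
Proof.
rewrite closedE => x /= nx U oU Ux; rewrite ltNge; apply/negP => U0; apply: nx.
have : nbhs x U by exact: open_nbhs_nbhs.
by apply: filterS => y Uy /(_ U oU Uy); rewrite ltNge U0.
Qed.

(** The supremum over k of |a_k| (|x| - k)^+, to which only the finitely many k
    below |x| contribute. *)
Lemma cvx_growth (a : nat -> R) : exists p : E -> R,
  [/\ cvx p, forall x, 0 <= p x & forall k (x : E), k.+1%:R < `|x| -> a k <= p x].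
Proof.
pose u k (x : E) := Num.max (`|a k| * (`|x| + - k%:R)) 0.
have ub (x : E) : has_ubound [set u k x | k in [set: nat]].
  pose K := (Num.truncn `|x|).+1.
  have xK : `|x| < K%:R by exact: truncnS_gt.
  exists (\sum_(k < K) u k x) => _ [k _ <-].
  have [kK|Kk] := ltnP k K.
    rewrite (bigD1 (Ordinal kK))//= lerDl; apply: sumr_ge0 => i _.
    by rewrite le_max lexx orbT.
  rewrite /u max_r; first by apply: sumr_ge0 => i _; rewrite le_max lexx orbT.
  rewrite mulr_ge0_le0// subr_le0; apply: ltW; apply: lt_le_trans xK _.
  by rewrite ler_nat.
have pu k (x : E) : u k x <= sup [set u k x | k in [set: nat]].
  by apply: ub_le_sup => //; exists k.
exists (fun x => sup [set u k x | k in [set: nat]]); split.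
- apply: cvx_sup => // k _.
  apply: cvx_max; last exact: cvx_cst.
  apply: cvxZ => //; apply: cvxD; [exact: cvx_norm|exact: cvx_cst].
- by move=> x; apply: le_trans (pu 0%N x); rewrite /u le_max lexx orbT.
- move=> k x kx; apply: le_trans (pu k x); rewrite /u le_max; apply/orP; left.
  apply: le_trans (ler_norm _) _; rewrite ler_peMr//.
  by move: kx; rewrite -natr1; lra.
Qed.

(** Let m_k be the mass of |x| > k + 1.  If every m_k were positive, a convex p >= 0
    with p >= k / m_k there would have integral at least k for all k. *)
Lemma compact_measure_support mu : (mu setT < +oo)%E ->
  (forall h, cvx h -> (\int[mu]_x (h x)%:E)%E \is a fin_num) ->
  compact (measure_support mu).
Proof.
move=> mufin hfin.
pose Q (r : R) : set B := [set x : E | r < `|x|].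
have oQ r : open (Q r : set E).
  apply: (@open_comp _ _ (fun x : E => `|x|) [set t | r < t]); last exact: open_gt.
  by move=> x _; exact: norm_continuous.
have [k Qk] : exists k : nat, mu (Q k.+1%:R) = 0%E.
  apply: contrapT => /forallNP Q0.
  pose m k := fine (mu (Q k.+1%:R)).
  have mE k : mu (Q k.+1%:R) = (m k)%:E.
    rewrite /m fineK// ge0_fin_numE//; apply: le_lt_trans mufin.
    by apply: le_measure; rewrite ?inE//; exact: open_borel.
  have m0 k : 0 < m k.
    by rewrite -lte_fin -mE lt0e measure_ge0 andbT; apply/eqP/Q0.
  have [p [cp p0 pa]] := cvx_growth (fun k => k%:R / m k).
  have kp k : (k%:R%:E <= \int[mu]_x (p x)%:E)%E.
    apply: (@le_trans _ _ (\int[mu]_x ((k%:R / m k)%:E * (\1_(Q k.+1%:R) x)%:E))%E).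
      have mQ : measurable (Q k.+1%:R) by exact: open_borel.
      rewrite ge0_integralZl_EFin//.
      - by rewrite integral_indic// setIT mE -EFinM divfK// gt_eqF.
      - by apply/measurable_EFinP; exact: measurable_indic.
      - by rewrite divr_ge0// ltW.
    apply: ge0_le_integral => //.
    - move=> x _; rewrite -EFinM lee_fin mulr_ge0// divr_ge0// ltW//.
    - apply: measurable_funeM; apply/measurable_EFinP; apply: measurable_indic.
      exact: open_borel.
    - by apply: measurable_EFin_dc; exact: dc_cvx.
    - move=> x _; rewrite -EFinM lee_fin indicE; case: (pselect (Q k.+1%:R x)) => Qx.
        by rewrite mem_set// mulr1; exact: pa.
      by rewrite memNset// mulr0.
  have := hfin p cp; case: (integral _ _ _) kp => // r kp _.
  have := kp (Num.truncn r).+1; rewrite lee_fin leNgt; apply/negP; rewrite negbK.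
  exact: truncnS_gt.
apply: bounded_closed_compact; last exact: closed_measure_support.
exists k.+1%:R; split; first exact: num_real.
move=> M kM x sx; apply: le_trans (ltW kM); rewrite leNgt; apply/negP => kx.
by have := sx _ (oQ k.+1%:R) kx; rewrite Qk ltxx.
Qed.

End SupportUniqueness.

(** * The representation theorem *)

Section Main.
Variables (R : realType) (n : nat) (F : ('rV[R]_n -> R) -> R).
Hypotheses (Flin : linear_functional F) (Fincr : increasing_functional F).
Local Notation G := (fun h => F (exp_conj h)).

Lemma cone_linear_functional : cone_linear G.
Proof.
move=> h g a b ch cg a0 b0 /=.
have LCh := LCsc_exp_conj ch; have LCg := LCsc_exp_conj cg.
rewrite -(Flin LCh LCg a0 b0) !exp_conj_dilation// !supp_exp_conj//.
have cah : cvx (fun y => a * h y) by apply: cvxZ => //; exact: ltW.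
have cbg : cvx (fun y => b * g y) by apply: cvxZ => //; exact: ltW.
rewrite (exp_conj_sup_convolution (LCsc_exp_conj cah) (LCsc_exp_conj cbg)).
by rewrite (supp_exp_conj cah) (supp_exp_conj cbg).
Qed.

Lemma cone_monotone_functional : cone_monotone G.
Proof.
move=> h g ch cg hg; apply: Fincr; [exact: LCsc_exp_conj|exact: LCsc_exp_conj|].
exact: exp_conj_mono.
Qed.

(** By duality every finite convex function is the support function of an element
    of LC_n^sc, so F and G are represented by the same measures. *)
Lemma represents_cvx (mu : {measure set (borelE R n) -> \bar R}) :
  represents F mu <->
  forall h, cvx h -> ((G h)%:E = \int[mu]_x (h x)%:E)%E.
Proof.
split=> [Fmu h ch|Fmu f LCf].
  rewrite (Fmu _ (LCsc_exp_conj ch)); apply: eq_integral => x _.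
  by rewrite suppE ?supp_exp_conj//; exact: LCsc_exp_conj.
rewrite {1}(exp_conj_suppE LCf) (Fmu _ (cvx_supp LCf)).
by apply: eq_integral => x _; rewrite suppE.
Qed.

End Main.

Theorem theorem1p7 (R : realType) (n : nat) (hn : (1 <= n)%N)
    (F : ('rV[R]_n -> R) -> R)
    (Flin : linear_functional F) (Fincr : increasing_functional F) :
  exists mu : {measure set (borelE R n) -> \bar R},
    [/\ (mu setT < +oo)%E, compact (measure_support mu) & represents F mu] /\
    forall nu : {measure set (borelE R n) -> \bar R},
      (nu setT < +oo)%E -> compact (measure_support nu) -> represents F nu ->
      forall A : set (borelE R n), measurable A -> nu A = mu A.
Proof.
have [L [PL LG]] := cone_extension (cone_linear_functional Flin)
  (cone_monotone_functional Fincr).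
have [mu [mufin muL]] := dc_representation PL.
have muF : represents F mu.
  by apply/represents_cvx => h ch; rewrite muL ?LG//; exact: dc_cvx.
have fin (nu : {measure set (borelE R n) -> \bar R}) : represents F nu ->
    forall h, cvx h -> (\int[nu]_x (h x)%:E)%E \is a fin_num.
  by move=> /represents_cvx nuF h ch; rewrite -nuF.
exists mu; split; first by split => //; apply: compact_measure_support => //; exact: fin.
move=> nu nufin _ nuF A mA; apply: integral_dc_measure_unique => // v dv v0.
apply: integral_dc_unique => // [h ch|h ch]; first exact: fin.
by move/represents_cvx: muF => <-//; move/represents_cvx: nuF => <-.
Qed.
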